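(* Let $(\Omega(A),\mathrm d)$ be a differential graded algebra on an algebra $A$ over a field $k$, and let $\tau$ be a degree-preserving derivation of the algebra $\Omega(A)$ commuting with $\mathrm d$. Then the super-Hopf algebra $\Omega(t,\mathrm dt)$ with parameter $\lambda$ acts on $\Omega(A)$, and the super-semidirect product $$\Omega(A_t)=\Omega(A)\rtimes\Omega(t,\mathrm dt)$$ is an inner differential graded algebra. The relations and exterior derivative are $$[t,\omega]=\lambda(\tau-|\omega|)\omega,\quad\forall\omega\in\Omega(A),\qquad[\mathrm dt,\ \}=\lambda\,\mathrm d,$$ where $[\ ,\ \}$ is the graded commutator.
   Context: A DGA on $A$ is an associative graded algebra $\Omega=\oplus_{n\ge0}\Omega^n$ with $\Omega^0=A$ and a graded derivation $\mathrm d$ of degree $1$ with $\mathrm d^2=0$. It is inner if there is a distinguished 1-form that generates $\mathrm d$ by graded commutator (here $\mathrm dt$, up to the factor $\lambda$). $0\neq\lambda\in k$ is a parameter. $\Omega(t,\mathrm dt)$ is the DGA on $k[t]$ generated by $t$ (degree 0) and $\mathrm dt$ (degree 1) with relations $[\mathrm dt,t]=\lambda\,\mathrm dt$, $\mathrm dt\,\mathrm dt=0$; it is a super-Hopf algebra with $\Delta t=t\otimes1+1\otimes t$, $\Delta\mathrm dt=\mathrm dt\otimes1+1\otimes\mathrm dt$. $A_t=A\rtimes k[t]$ is the algebra generated by $A$ and $t$ with relations $[t,a]=\lambda\tau(a)$ for $a\in A$. For a super-Hopf algebra $H$ acting (by $\triangleright$) on a super-algebra $B$ as a super-module algebra, the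 super-semidirect product $B\rtimes H$ has underlying space $B\otimes H$ and product $(\omega\phi)(\eta\psi)=(-1)^{|\phi_{(2)}||\eta|}\omega(\phi_{(1)}\triangleright\eta)\phi_{(2)}\psi$ for $\omega,\eta\in B$, $\phi,\psi\in H$, where $\phi_{(1)}\otimes\phi_{(2)}$ is the super-coproduct of $\phi$. *)

(* Defs.v *)
From HB Require Import structures.
From mathcomp Require Import all_boot all_order all_algebra.
From mathcomp Require Import boolp.

Set Implicit Arguments.
Unset Strict Implicit.
Unset Printing Implicit Defensive.

Import GRing.Theory.
Local Open Scope ring_scope.
Local Open Scope quotient_scope.

Reserved Notation "u ⊗ v" (at level 39, left associativity).

(* The tensor product U ⊗ V of modules: formal sums of pairs (u, v), two of  *)
(* which are identified when every bilinear map takes the same value on them *)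
Section Tensor.
Context {k : fieldType} (U V : lmodType k).

Definition tsum (M : lmodType k) (f : U -> V -> M) (s : seq (U * V)) : M :=
  \sum_(p <- s) f p.1 p.2.

Definition teq (s1 s2 : seq (U * V)) : bool :=
  `[< forall (M : lmodType k) (f : U -> V -> M),
        bilinear_for *:%R *:%R f -> tsum f s1 = tsum f s2 >].

Lemma teqP s1 s2 : reflect (forall (M : lmodType k) (f : U -> V -> M),
  bilinear_for *:%R *:%R f -> tsum f s1 = tsum f s2) (teq s1 s2).
Proof. exact: asboolP. Qed.

Lemma teq_refl : reflexive teq.
Proof. by move=> s; apply/teqP. Qed.

Lemma teq_sym : symmetric teq.
Proof.
by move=> s1 s2; apply/teqP/teqP => h M f bf; rewrite h.
Qed.

Lemma teq_trans : transitive teq.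
Proof.
by move=> s2 s1 s3 /teqP h1 /teqP h2; apply/teqP => M f bf; rewrite h1 // h2.
Qed.

Canonical teq_equiv := EquivRel teq teq_refl teq_sym teq_trans.

Definition tens : Type := {eq_quot teq}.

HB.instance Definition _ : EqQuotient _ teq tens := EqQuotient.on tens.
HB.instance Definition _ := Choice.on tens.

Definition ten (u : U) (v : V) : tens := \pi_tens [:: (u, v)].

(* the linear map induced by f, meaningful when f is bilinear *)
Definition tlift (M : lmodType k) (f : U -> V -> M) (x : tens) : M :=
  tsum f (repr x).

Lemma tlift_pi (M : lmodType k) (f : U -> V -> M) s :
  bilinear_for *:%R *:%R f -> tlift f (\pi_tens s) = tsum f s.
Proof.
move=> bf; rewrite /tlift; case: piP => s' /eqmodP /teqP h.
by rewrite h.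
Qed.

Definition tzero : tens := \pi_tens [::].
Definition topp (x : tens) : tens :=
  \pi_tens [seq (- p.1, p.2) | p <- repr x].
Definition tadd (x y : tens) : tens := \pi_tens (repr x ++ repr y).
Definition tscale (a : k) (x : tens) : tens :=
  \pi_tens [seq (a *: p.1, p.2) | p <- repr x].

Section Lift.
Context (M : lmodType k) (f : U -> V -> M) (bf : bilinear_for *:%R *:%R f).

Lemma tsumZ a s : tsum f [seq (a *: p.1, p.2) | p <- s] = a *: tsum f s.
Proof.
rewrite /tsum big_map scaler_sumr; apply: eq_bigr => p _ /=.
exact: (scalable_linear (bf.1 p.2)).
Qed.

Lemma tsumN s : tsum f [seq (- p.1, p.2) | p <- s] = - tsum f s.
Proof.
rewrite -scaleN1r -tsumZ /tsum !big_map; apply: eq_bigr => p _ /=.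
by rewrite scaleN1r.
Qed.

Lemma tlift_add x y : tlift f (tadd x y) = tlift f x + tlift f y.
Proof. by rewrite tlift_pi // /tsum big_cat. Qed.

Lemma tlift_opp x : tlift f (topp x) = - tlift f x.
Proof. by rewrite tlift_pi // tsumN. Qed.

Lemma tlift_scale a x : tlift f (tscale a x) = a *: tlift f x.
Proof. by rewrite tlift_pi // tsumZ. Qed.

Lemma tlift_zero : tlift f tzero = 0.
Proof. by rewrite tlift_pi // /tsum big_nil. Qed.

End Lift.

Lemma tens_eqP (x y : tens) :
  (forall (M : lmodType k) (f : U -> V -> M),
     bilinear_for *:%R *:%R f -> tlift f x = tlift f y) -> x = y.
Proof.
move=> h; rewrite -[x]reprK -[y]reprK; apply/eqmodP/teqP => M f bf.
exact: h.
Qed.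

Lemma taddA : associative tadd.
Proof. by move=> x y z; apply: tens_eqP => M f bf; rewrite !tlift_add // addrA. Qed.
Lemma taddC : commutative tadd.
Proof. by move=> x y; apply: tens_eqP => M f bf; rewrite !tlift_add // addrC. Qed.
Lemma tadd0 : left_id tzero tadd.
Proof. by move=> x; apply: tens_eqP => M f bf; rewrite tlift_add // tlift_zero // add0r. Qed.
Lemma taddN : left_inverse tzero topp tadd.
Proof.
by move=> x; apply: tens_eqP => M f bf;
   rewrite tlift_add // tlift_opp // tlift_zero // addNr.
Qed.

HB.instance Definition _ := GRing.isZmodule.Build tens taddA taddC tadd0 taddN.

Lemma tscaleA a b x : tscale a (tscale b x) = tscale (a * b) x.
Proof. by apply: tens_eqP => M f bf; rewrite !tlift_scale // scalerA. Qed.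
Lemma tscale1 : left_id 1 tscale.
Proof. by move=> x; apply: tens_eqP => M f bf; rewrite tlift_scale // scale1r. Qed.
Lemma tscaleDr : right_distributive tscale +%R.
Proof.
move=> a x y; apply: tens_eqP => M f bf.
rewrite -[x + y]/(tadd x y) -[RHS]/(tlift f (tadd (tscale a x) (tscale a y))).
by rewrite tlift_scale // !tlift_add // !tlift_scale // scalerDr.
Qed.
Lemma tscaleDl x : {morph tscale^~ x : a b / a + b}.
Proof.
move=> a b; apply: tens_eqP => M f bf.
rewrite -[RHS]/(tlift f (tadd (tscale a x) (tscale b x))).
by rewrite tlift_add // !tlift_scale // scalerDl.
Qed.

HB.instance Definition _ :=
  GRing.Zmodule_isLmodule.Build k tens tscaleA tscale1 tscaleDr tscaleDl.

Lemma tliftE (M : lmodType k) (f : U -> V -> M) u v :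
  bilinear_for *:%R *:%R f -> tlift f (ten u v) = f u v.
Proof. by move=> bf; rewrite tlift_pi // /tsum big_seq1. Qed.

Lemma tlift_linear (M : lmodType k) (f : U -> V -> M) :
  bilinear_for *:%R *:%R f -> linear (tlift f).
Proof.
move=> bf a x y; rewrite -[LHS]/(tlift f (tadd (tscale a x) y)).
by rewrite tlift_add // tlift_scale.
Qed.

Lemma ten_bilinear : bilinear_for *:%R *:%R ten.
Proof.
split=> [v|u] a x y; apply: tens_eqP => M f bf;
  rewrite (tlift_linear bf) !tliftE //.
  by rewrite (bf.1 v).
by rewrite (bf.2 u).
Qed.

Lemma tens_sum (x : tens) : exists s : seq (U * V),
  x = \sum_(p <- s) ten p.1 p.2.
Proof.
exists (repr x); apply: tens_eqP => M f bf.
have lf := tlift_linear bf.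
pose F := GRing.isLinear.Build _ _ _ _ (tlift f) lf.
pose g : {linear tens -> M} := HB.pack (tlift f) F.
rewrite -[RHS]/(g _) linear_sum [LHS]/tlift /tsum.
by apply: eq_bigr => p _; rewrite -[RHS]/(tlift f _) tliftE.
Qed.

End Tensor.

Notation "u ⊗ v" := (ten u v) : ring_scope.

Section TensorTheory.
Context {k : fieldType}.
Implicit Types U V M : lmodType k.

Lemma ten_linl U V a (x y : U) (v : V) :
  (a *: x + y) ⊗ v = a *: (x ⊗ v) + y ⊗ v.
Proof. exact: (ten_bilinear U V).1. Qed.

Lemma ten_linr U V a (u : U) (x y : V) :
  u ⊗ (a *: x + y) = a *: (u ⊗ x) + u ⊗ y.
Proof. exact: (ten_bilinear U V).2. Qed.

Lemma bilinearD U V M (f g : U -> V -> M) :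
  bilinear_for *:%R *:%R f -> bilinear_for *:%R *:%R g ->
  bilinear_for *:%R *:%R (fun x y => f x y + g x y).
Proof.
move=> bf bg; split=> [v|u] a x y.
  by rewrite /= (bf.1 v) (bg.1 v) /= scalerDr addrACA.
by rewrite /= (bf.2 u) (bg.2 u) /= scalerDr addrACA.
Qed.

Lemma tlift_param (N : lmodType k) U V M (F : N -> U -> V -> M) (w : tens U V) :
  (forall u v, linear (fun x => F x u v)) -> linear (fun x => tlift (F x) w).
Proof.
move=> lF a x y; rewrite /tlift /tsum scaler_sumr -big_split.
by apply: eq_bigr => p _ /=; rewrite lF.
Qed.

Lemma linear_fun0 U V (f : U -> V) : linear f -> f 0 = 0.
Proof. by move=> lf; rewrite -[0 in LHS](addNr 0) -scaleN1r lf scaleN1r addNr. Qed.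
Lemma linear_funD U V (f : U -> V) x y : linear f -> f (x + y) = f x + f y.
Proof. by move=> lf; rewrite -[x in LHS]scale1r lf scale1r. Qed.
Lemma linear_funZ U V (f : U -> V) a x : linear f -> f (a *: x) = a *: f x.
Proof. by move=> lf; rewrite -[a *: x]addr0 lf linear_fun0 ?addr0. Qed.
Lemma linear_fun_sum U V (f : U -> V) (I : Type) (s : seq I) (F : I -> U) :
  linear f -> f (\sum_(i <- s) F i) = \sum_(i <- s) f (F i).
Proof.
move=> lf; elim: s => [|i s ih]; first by rewrite !big_nil linear_fun0.
by rewrite !big_cons linear_funD ?ih.
Qed.

Lemma tens_ext U V M (f g : tens U V -> M) : linear f -> linear g ->
  (forall u v, f (u ⊗ v) = g (u ⊗ v)) -> f =1 g.
Proof.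
move=> lf lg h w; have [s ->] := tens_sum w.
by rewrite !linear_fun_sum //; apply: eq_bigr.
Qed.

End TensorTheory.

(* Graded algebras G = ⊕_n G^n, presented by the projections onto the G^n.   *)
(* They are the super-algebras used here, with parity the degree modulo 2.   *)
Record gradedAlg (k : fieldType) := GradedAlg {
  ga_alg :> algType k;
  gpr : nat -> {linear ga_alg -> ga_alg};
  gpr_gpr : forall m n x, gpr m (gpr n x) = if m == n then gpr n x else 0;
  gpr_sum : forall x, exists N : nat, x = \sum_(n < N) gpr n x;
  gpr_1 : gpr 0%N 1 = 1;
  gpr_M : forall m n x y, gpr m x = x -> gpr n y = y ->
            gpr (m + n)%N (x * y) = x * y }.

Section Graded.
Context {k : fieldType}.

Definition homog (G : gradedAlg k) (n : nat) (x : G) : Prop := gpr G n x = x.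

Definition gbound (G : gradedAlg k) (x : G) : nat := sval (cid (gpr_sum x)).

(* sum over the homogeneous components of x *)
Definition gsum (G : gradedAlg k) (M : zmodType) (f : nat -> G -> M) (x : G) : M :=
  \sum_(n < gbound x) f n (gpr G n x).

(* gsign n x = (-1)^{n|x|} x *)
Definition gsign (G : gradedAlg k) (n : nat) (x : G) : G :=
  gsum (fun m xm => (-1) ^+ (m * n) *: xm) x.

(* the graded commutator [x, y} = x y - (-1)^{n|y|} y x, for x of degree n *)
Definition gcomm (G : gradedAlg k) (n : nat) (x y : G) : G :=
  x * y - gsign n y * x.

Lemma gsum_homog (G : gradedAlg k) (M : zmodType) (f : nat -> G -> M) m (x : G) :
  (forall n, f n 0 = 0) -> homog m x -> gsum f x = f m x.
Proof.
move=> f0 hx; rewrite /gsum /gbound; case: cid => N /= hN.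
have pr n : gpr G n x = if n == m then x else 0.
  by rewrite -{1}hx gpr_gpr; case: eqP => // _.
case: (ltnP m N) => hm.
  rewrite (bigD1 (Ordinal hm)) //= big1 ?addr0 ?pr ?eqxx // => i hi.
  by rewrite pr -val_eqE in hi *; rewrite (negPf hi) f0.
have x0 : x = 0.
  rewrite hN big1 // => i _; rewrite pr; case: eqP => // e.
  by have := ltn_ord i; rewrite e ltnNge hm.
by rewrite x0 f0 big1 // => i _; rewrite linear0 f0.
Qed.

Lemma gsignE (G : gradedAlg k) m n (x : G) :
  homog m x -> gsign n x = (-1) ^+ (m * n) *: x.
Proof. by move=> hx; rewrite /gsign (gsum_homog _ hx) // => i; rewrite scaler0. Qed.

Lemma gcommE (G : gradedAlg k) m n (x y : G) :
  homog n y -> gcomm m x y = x * y - (-1) ^+ (n * m) *: (y * x).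
Proof. by move=> hy; rewrite /gcomm (gsignE _ hy) scalerAl. Qed.

(* the product (x ⊗ y)(x' ⊗ y') = (-1)^{|y||x'|} x x' ⊗ y y' *)
Definition smul (G : gradedAlg k) (u v : tens G G) : tens G G :=
  tlift (fun x y => tlift (fun x' y' =>
    gsum (fun n yn => (x * gsign n x') ⊗ (yn * y')) y) v) u.

Definition thomog (G : gradedAlg k) (n : nat) (u : tens G G) : Prop :=
  exists s : seq (G * G), u = \sum_(p <- s) p.1 ⊗ p.2 /\
    forall p, p \in s -> exists i j, [/\ homog i p.1, homog j p.2 & (i + j = n)%N].

End Graded.

Section GradedTheory.
Context {k : fieldType} (G : gradedAlg k).

Lemma gpr_bound n (x : G) : (gbound x <= n)%N -> gpr G n x = 0.
Proof.
rewrite /gbound; case: cid => N /= hN le; rewrite hN linear_sum big1 // => i _.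
by rewrite gpr_gpr; case: eqP => // e; have := ltn_ord i; rewrite -e ltnNge le.
Qed.

Lemma gsum_widen (M : zmodType) (f : nat -> G -> M) (x : G) N :
  (forall n, f n 0 = 0) -> (gbound x <= N)%N ->
  gsum f x = \sum_(n < N) f n (gpr G n x).
Proof.
move=> f0 le; rewrite /gsum.
rewrite (big_ord_widen N (fun n => f n (gpr G n x)) le) [LHS]big_mkcond /=.
by apply: eq_bigr => i _; case: ltnP => // h; rewrite gpr_bound ?f0.
Qed.

Lemma gsum_linear (M : lmodType k) (f : nat -> G -> M) :
  (forall n, linear (f n)) -> linear (gsum f).
Proof.
move=> lf a x y; have f0 n : f n 0 = 0 by apply: linear_fun0.
pose N := maxn (gbound (a *: x + y)) (maxn (gbound x) (gbound y)).
rewrite (@gsum_widen _ _ (a *: x + y) N) ?leq_maxl //.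
rewrite (@gsum_widen _ _ x N) ?(@gsum_widen _ _ y N) ?leq_max ?leqnn ?orbT //.
rewrite scaler_sumr -big_split; apply: eq_bigr => n _ /=.
by rewrite linearP lf.
Qed.

Lemma gsign_linear n : linear (@gsign k G n).
Proof.
apply: gsum_linear => m a x y.
by rewrite scalerDr !scalerA [a * _]mulrC.
Qed.

Lemma tens_ext_homog (M : lmodType k) (f g : tens G G -> M) :
  linear f -> linear g ->
  (forall m n (x y : G), homog m x -> homog n y -> f (x ⊗ y) = g (x ⊗ y)) ->
  f =1 g.
Proof.
move=> lf lg h; apply: tens_ext => // u v.
have hp (w : G) n : homog n (gpr G n w) by rewrite /homog gpr_gpr eqxx.
have [M1 e1] := gpr_sum u; have [M2 e2] := gpr_sum v.
have L1 w : linear (fun x : G => f (x ⊗ w)) by move=> a x y; rewrite ten_linl lf.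
have L2 w : linear (fun x : G => g (x ⊗ w)) by move=> a x y; rewrite ten_linl lg.
have R1 w : linear (fun x : G => f (w ⊗ x)) by move=> a x y; rewrite ten_linr lf.
have R2 w : linear (fun x : G => g (w ⊗ x)) by move=> a x y; rewrite ten_linr lg.
rewrite e1 (linear_fun_sum _ _ (L1 v)) (linear_fun_sum _ _ (L2 v)).
apply: eq_bigr => i _; rewrite e2.
rewrite (linear_fun_sum _ _ (R1 _)) (linear_fun_sum _ _ (R2 _)).
by apply: eq_bigr => j _; apply: h; apply: hp.
Qed.

Lemma gsign_lin n a (x y : G) :
  gsign n (a *: x + y) = a *: gsign n x + gsign n y.
Proof. exact: gsign_linear. Qed.

Lemma smul_inner (x y : G) : bilinear_for *:%R *:%R (fun x' y' : G =>
  gsum (fun n yn => (x * gsign n x') ⊗ (yn * y')) y).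
Proof.
split=> [v|u] a b c; rewrite /= /gsum scaler_sumr -big_split;
  apply: eq_bigr => n _ /=.
  by rewrite gsign_lin mulrDr -scalerAr ten_linl.
by rewrite mulrDr -scalerAr ten_linr.
Qed.

Lemma smul_outer v : bilinear_for *:%R *:%R (fun x y : G =>
  tlift (fun x' y' : G => gsum (fun n yn => (x * gsign n x') ⊗ (yn * y')) y) v).
Proof.
split=> [y|x].
  apply: (@tlift_param _ _ _ _ _ (fun x (x' y' : G) =>
    gsum (fun n yn => (x * gsign n x') ⊗ (yn * y')) y)) => x' y' a b c.
  rewrite /= /gsum scaler_sumr -big_split; apply: eq_bigr => n _ /=.
  by rewrite mulrDl -scalerAl ten_linl.
apply: (@tlift_param _ _ _ _ _ (fun y (x' y' : G) =>
  gsum (fun n yn => (x * gsign n x') ⊗ (yn * y')) y)) => x' y'.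
by apply: gsum_linear => n a b c; rewrite mulrDl -scalerAl ten_linr.
Qed.

Lemma smul_bilinear : bilinear_for *:%R *:%R (@smul k G).
Proof.
split=> [v|u]; first exact: (tlift_linear (smul_outer v)).
apply: (@tlift_param _ _ _ _ _ (fun v (x y : G) =>
  tlift (fun x' y' => gsum (fun n yn => (x * gsign n x') ⊗ (yn * y')) y) v)).
by move=> x y; apply: (tlift_linear (smul_inner x y)).
Qed.

Lemma smulE m n (x y x' y' : G) : homog m y -> homog n x' ->
  smul (x ⊗ y) (x' ⊗ y') = (-1) ^+ (m * n) *: ((x * x') ⊗ (y * y')).
Proof.
move=> hy hx'; rewrite /smul (tliftE _ _ (smul_outer _)).
rewrite (tliftE _ _ (smul_inner _ _)) (gsum_homog _ hy) => [|i]; last first.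
  by rewrite mul0r (linear_fun0 (fun a b c => ten_linr a (x * gsign i x') b c)).
rewrite (gsignE _ hx') mulnC -scalerAr.
exact: (linear_funZ _ _ (fun a b c => ten_linl a b c (y * y'))).
Qed.

Lemma homogP m (x : G) : homog m x -> gpr G m x = x. Proof. by []. Qed.
Lemma homog_lin m a (x y : G) : homog m x -> homog m y -> homog m (a *: x + y).
Proof. by move=> hx hy; rewrite /homog linearP hx hy. Qed.
Lemma homogM m n (x y : G) : homog m x -> homog n y -> homog (m + n) (x * y).
Proof. exact: gpr_M. Qed.

End GradedTheory.

Record superHopf (k : fieldType) := SuperHopf {
  sh_ga :> gradedAlg k;
  coprod : {linear sh_ga -> tens sh_ga sh_ga};
  counit : {linear sh_ga -> k^o};
  antipode : {linear sh_ga -> sh_ga};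
  coprod_deg : forall n (h : sh_ga), homog n h -> thomog n (coprod h);
  counit_deg : forall n (h : sh_ga), homog n h -> n != 0%N -> counit h = 0;
  antipode_deg : forall n (h : sh_ga), homog n h -> homog n (antipode h);
  coprodA : forall h,
    tlift (fun x y => x ⊗ coprod y) (coprod h) =
    tlift (fun x y => tlift (fun a b => a ⊗ (b ⊗ y)) (coprod x)) (coprod h);
  counitl : forall h, tlift (fun x y => (counit x : k) *: y) (coprod h) = h;
  counitr : forall h, tlift (fun x y => (counit y : k) *: x) (coprod h) = h;
  coprod1 : coprod 1 = 1 ⊗ 1;
  coprodM : forall g h, coprod (g * h) = smul (coprod g) (coprod h);
  counit1 : counit 1 = 1;
  counitM : forall g h, counit (g * h) = (counit g : k) * counit h;
  antipodel : forall h,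
    tlift (fun x y => antipode x * y) (coprod h) = (counit h : k)%:A;
  antipoder : forall h,
    tlift (fun x y => x * antipode y) (coprod h) = (counit h : k)%:A }.

Section SuperSemidirect.
Context {k : fieldType} (H : superHopf k) (B : gradedAlg k).

(* In both product formulas h_(1) ⊗ h_(2) is the super-coproduct of h, and   *)
(* gsign n h_(2) is the Koszul sign times h_(2).                             *)
Record super_module_algebra (act : H -> B -> B) : Prop := SuperModuleAlgebra {
  sma_bilinear : bilinear_for *:%R *:%R act;
  sma_deg : forall m n h b, homog m h -> homog n b -> homog (m + n) (act h b);
  sma_1 : forall b, act 1 b = b;
  sma_M : forall g h b, act (g * h) b = act g (act h b);
  sma_unit : forall h, act h 1 = (counit H h : k)%:A;
  sma_mul : forall n h b c, homog n b ->
    act h (b * c) =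
    tlift (fun h1 h2 => act h1 b * act (gsign n h2) c) (coprod H h) }.

(* W, with j w h for the element w h, is the super-semidirect product of B   *)
(* and H: bijectivity of tlift j says that W has underlying space B ⊗ H      *)
Record super_semidirect (act : H -> B -> B) (W : gradedAlg k) (j : B -> H -> W) :
    Prop := SuperSemidirect {
  ssd_bilinear : bilinear_for *:%R *:%R j;
  ssd_tensor : bijective (tlift j);
  ssd_deg : forall m n w h, homog m w -> homog n h -> homog (m + n) (j w h);
  ssd_mul : forall n w h b g, homog n b ->
    j w h * j b g =
    tlift (fun h1 h2 => j (w * act h1 b) (gsign n h2 * g)) (coprod H h) }.

End SuperSemidirect.

(* Differential graded algebras Omega on A, with A identified with Omega^0   *)
Record dga (k : fieldType) (A : algType k) := Dga {
  dga_ga :> gradedAlg k;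
  dga_in : {lrmorphism A -> dga_ga};
  dga_in_inj : injective dga_in;
  dga_deg0 : forall w : dga_ga, homog 0 w <-> exists a, w = dga_in a;
  dga_d : {linear dga_ga -> dga_ga};
  dga_d_deg : forall n w, homog n w -> homog n.+1 (dga_d w);
  dga_dM : forall n v w, homog n v ->
    dga_d (v * w) = dga_d v * w + (-1) ^+ n *: (v * dga_d w);
  dga_dd : forall w, dga_d (dga_d w) = 0 }.

Definition inner_dga (k : fieldType) (A : algType k) (D : dga A) : Prop :=
  exists2 theta : D, homog 1 theta & forall w, dga_d D w = gcomm 1 theta w.

(* At is the algebra generated by A and t with the relations                 *)
(* [t, a] = lam delta(a) for a in A                                          *)
Definition generated_by_t (k : fieldType) (lam : k) (A : algType k)
    (delta : A -> A) (At : algType k) (i : {lrmorphism A -> At}) (t : At) : Prop :=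
  (forall a, t * i a - i a * t = lam *: i (delta a)) /\
  forall (C : algType k) (f : {lrmorphism A -> C}) (c : C),
    (forall a, c * f a - f a * c = lam *: f (delta a)) ->
    exists g : {lrmorphism At -> C},
      [/\ forall a, g (i a) = f a, g t = c &
          forall g' : {lrmorphism At -> C},
            (forall a, g' (i a) = f a) -> g' t = c -> g' =1 g].

(* Omega(t, dt): OTDt p q stands for p(t) + q(t) dt, and the relation        *)
(* [dt, t] = lam dt reads dt p(t) = p(t + lam) dt                            *)
Record otdt (k : fieldType) (lam : k) : Type :=
  OTDt { opol : {poly k}; oform : {poly k} }.

Section OmegaTDt.
Context {k : fieldType} (lam : k).

Local Notation H := (otdt lam).
Local Notation OT := (@OTDt k lam).

Definition opair (x : H) : {poly k} * {poly k} := (opol x, oform x).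
Definition ounpair (p : {poly k} * {poly k}) : H := OT p.1 p.2.
Lemma opairK : cancel opair ounpair. Proof. by case. Qed.

HB.instance Definition _ := Choice.copy H (can_type opairK).

Lemma oeqP (x y : H) : opol x = opol y -> oform x = oform y -> x = y.
Proof. by case: x y => [p q] [p' q'] /= -> ->. Qed.

Definition oadd (x y : H) : H := OT (opol x + opol y) (oform x + oform y).
Definition oopp (x : H) : H := OT (- opol x) (- oform x).
Definition oscale (a : k) (x : H) : H := OT (a *: opol x) (a *: oform x).

Lemma oaddA : associative oadd.
Proof. by move=> x y z; apply: oeqP; apply: addrA. Qed.
Lemma oaddC : commutative oadd.
Proof. by move=> x y; apply: oeqP; apply: addrC. Qed.
Lemma oadd0 : left_id (OT 0 0) oadd.
Proof. by move=> x; apply: oeqP; apply: add0r. Qed.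
Lemma oaddN : left_inverse (OT 0 0) oopp oadd.
Proof. by move=> x; apply: oeqP; apply: addNr. Qed.
HB.instance Definition _ := GRing.isZmodule.Build H oaddA oaddC oadd0 oaddN.

Lemma oscaleA a b x : oscale a (oscale b x) = oscale (a * b) x.
Proof. by apply: oeqP; apply: scalerA. Qed.
Lemma oscale1 : left_id 1 oscale.
Proof. by move=> x; apply: oeqP; apply: scale1r. Qed.
Lemma oscaleDr : right_distributive oscale +%R.
Proof. by move=> a x y; apply: oeqP; apply: scalerDr. Qed.
Lemma oscaleDl x : {morph oscale^~ x : a b / a + b}.
Proof. by move=> a b; apply: oeqP; apply: scalerDl. Qed.
HB.instance Definition _ :=
  GRing.Zmodule_isLmodule.Build k H oscaleA oscale1 oscaleDr oscaleDl.

Lemma opolD (x y : H) : opol (x + y) = opol x + opol y. Proof. by []. Qed.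
Lemma oformD (x y : H) : oform (x + y) = oform x + oform y. Proof. by []. Qed.
Lemma opolZ a (x : H) : opol (a *: x) = a *: opol x. Proof. by []. Qed.
Lemma oformZ a (x : H) : oform (a *: x) = a *: oform x. Proof. by []. Qed.

Definition oshift (p : {poly k}) : {poly k} := p \Po ('X + lam%:P).

Definition omul (x y : H) : H :=
  OT (opol x * opol y) (opol x * oform y + oform x * oshift (opol y)).

Definition oone : H := OT 1 0.

Lemma oshiftD p q : oshift (p + q) = oshift p + oshift q.
Proof. exact: comp_polyD. Qed.
Lemma oshiftM p q : oshift (p * q) = oshift p * oshift q.
Proof. exact: comp_polyM. Qed.
Lemma oshiftZ a p : oshift (a *: p) = a *: oshift p.
Proof. exact: comp_polyZ. Qed.
Lemma oshift1 : oshift 1 = 1.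
Proof. by rewrite /oshift -[1]/(1%:P) comp_polyC. Qed.
Lemma oshiftX : oshift 'X = 'X + lam%:P.
Proof. exact: comp_polyX. Qed.

Lemma omulA : associative omul.
Proof.
move=> x y z; apply: oeqP; rewrite /= ?oshiftM ?mulrA //.
by rewrite mulrDr mulrDl !mulrA addrA.
Qed.
Lemma omul1l : left_id oone omul.
Proof. by case=> p q; apply: oeqP; rewrite /= ?mul1r // mul0r addr0. Qed.
Lemma omul1r : right_id oone omul.
Proof. by case=> p q; apply: oeqP; rewrite /= ?mulr1 // mulr0 oshift1 mulr1 add0r. Qed.
Lemma omulDl : left_distributive omul +%R.
Proof.
move=> x y z; apply: oeqP; rewrite /= ?mulrDl //.
by rewrite addrACA.
Qed.
Lemma omulDr : right_distributive omul +%R.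
Proof.
move=> x y z; apply: oeqP; rewrite /= ?oshiftD ?mulrDr //.
by rewrite addrACA.
Qed.
Lemma oone_neq0 : oone != 0.
Proof. by apply/eqP => -[/eqP]; rewrite oner_eq0. Qed.

HB.instance Definition _ := GRing.Zmodule_isNzRing.Build H
  omulA omul1l omul1r omulDl omulDr oone_neq0.

Lemma oscaleAl (a : k) (x y : H) : a *: (x * y) = a *: x * y.
Proof.
by apply: oeqP; rewrite /= ?scalerDr !scalerAl.
Qed.
HB.instance Definition _ := GRing.Lmodule_isLalgebra.Build k H oscaleAl.

Lemma oscaleAr (a : k) (x y : H) : a *: (x * y) = x * (a *: y).
Proof.
apply: oeqP; rewrite /= ?oshiftZ ?scalerDr; first exact: scalerAr.
by rewrite -!scalerAr.
Qed.
HB.instance Definition _ := GRing.Lalgebra_isAlgebra.Build k H oscaleAr.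

Lemma opolM (x y : H) : opol (x * y) = opol x * opol y. Proof. by []. Qed.
Lemma oformM (x y : H) :
  oform (x * y) = opol x * oform y + oform x * oshift (opol y).
Proof. by []. Qed.

Definition ot : H := OT 'X 0.
Definition odt : H := OT 0 1.

Lemma odt_t : odt * ot - ot * odt = lam *: odt.
Proof.
apply: oeqP; rewrite /= ?mulr0 ?mul0r ?subrr ?scaler0 //.
by rewrite add0r mul1r mulr1 addr0 oshiftX addrAC subrr add0r alg_polyC.
Qed.

Lemma odt_dt : odt * odt = 0.
Proof. by apply: oeqP; rewrite /= /oshift ?comp_poly0 ?mulr0 ?mul0r ?addr0. Qed.

Lemma otdt_ind (P : H -> Prop) :
  (forall a x y, P x -> P y -> P (a *: x + y)) -> P 1 -> P odt ->
  (forall x, P x -> P (ot * x)) -> forall x, P x.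
Proof.
move=> Plin P1 Pdt Pt.
have P0 : P 0 by rewrite -(addNr 1) -scaleN1r; apply: Plin.
have Pp p : P (OT p 0).
  elim/poly_ind: p => // p c ih.
  have -> : OT (p * 'X + c%:P) 0 = c *: 1 + ot * OT p 0.
    apply: oeqP; rewrite /= ?mulr0 ?mul0r ?addr0 ?scaler0 //.
    by rewrite addrC ['X * _]mulrC alg_polyC.
  by apply: Plin => //; apply: Pt.
have Pq q : P (OT 0 q).
  elim/poly_ind: q => // q c ih.
  have -> : OT 0 (q * 'X + c%:P) = c *: odt + ot * OT 0 q.
    apply: oeqP; rewrite /= ?mulr0 ?mul0r ?addr0 ?scaler0 //.
    by rewrite addrC ['X * _]mulrC alg_polyC.
  by apply: Plin => //; apply: Pt.
case=> p q; have -> : OT p q = 1 *: OT p 0 + OT 0 q.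
  by rewrite scale1r; apply: oeqP; rewrite /= ?addr0 ?add0r.
by apply: Plin.
Qed.

Lemma otdt_ext (M : lmodType k) (f g : H -> M) : linear f -> linear g ->
  f 1 = g 1 -> f odt = g odt ->
  (forall x, f x = g x -> f (ot * x) = g (ot * x)) -> f =1 g.
Proof.
move=> lf lg h1 hdt ht x; elim/otdt_ind: x => // a x y hx hy.
by rewrite lf lg hx hy.
Qed.

(* the universal property of generators and relations *)
Lemma otdt_presentation (C : algType k) (x y : C) :
  y * x - x * y = lam *: y -> y * y = 0 ->
  exists g : {lrmorphism H -> C}, [/\ g ot = x, g odt = y &
    forall g' : {lrmorphism H -> C}, g' ot = x -> g' odt = y -> g' =1 g].
Proof.
move=> yx yy; pose h : {rmorphism {poly k} -> C} := horner_alg x.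
have hZ a p : h (a *: p) = a *: h p by rewrite -mul_polyC rmorphM /= horner_algC mulr_algl.
have hX : h 'X = x by apply: horner_algX.
have hC c : h c%:P = c%:A by apply: horner_algC.
pose g (w : H) : C := h (opol w) + h (oform w) * y.
have lg : linear g.
  move=> a u v; rewrite /g opolD oformD opolZ oformZ !rmorphD !hZ mulrDl -!scalerAl scalerDr.
  by rewrite addrACA.
have yh p : y * h p = h (oshift p) * y.
  elim/poly_ind: p => [|p c ih].
    by rewrite /oshift comp_poly0 !rmorph0 mul0r mulr0.
  rewrite oshiftD oshiftM oshiftX [oshift c%:P]comp_polyC.
  rewrite !(rmorphD, rmorphM) hX !hC.
  have yx' : y * x = (x + lam%:A) * y.
    by rewrite mulrDl -scalerAl mul1r -yx addrC subrK.
  rewrite mulrDr mulrA ih -mulrA yx' mulrA mulrDl; congr (_ + _).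
  by rewrite -scalerAr -scalerAl mul1r mulr1.
have gM : monoid_morphism g.
  split=> [|u v]; first by rewrite /g /= rmorph1 rmorph0 mul0r addr0.
  rewrite /g opolM oformM rmorphD !rmorphM !mulrDl !mulrDr -!addrA.
  congr (_ + (_ + _)); first by rewrite mulrA.
  by rewrite -!mulrA [y * (_ * y)]mulrA !yh -[_ * y * y]mulrA yy !mulr0 addr0.
pose G1 := GRing.isLinear.Build _ _ _ _ g lg.
pose G2 := GRing.isMonoidMorphism.Build _ _ g gM.
pose G : {lrmorphism H -> C} := HB.pack g G1 G2.
have gt : g ot = x by rewrite /g hX rmorph0 mul0r addr0.
have gdt : g odt = y by rewrite /g rmorph0 rmorph1 mul1r add0r.
exists G; split=> // g' g't g'dt; apply: otdt_ext.
- by move=> a u v; rewrite linearP.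
- by move=> a u v; rewrite [LHS]lg.
- by rewrite !rmorph1.
- by rewrite g'dt [RHS]gdt.
move=> u e; have e' : g' u = g u by [].
have gt' : g' (ot * u) = g' ot * g' u by apply: rmorphM.
by rewrite gt' -[RHS]/(g (ot * u)) gM.2 g't gt e'.
Qed.

Definition ogpr (n : nat) (x : H) : H :=
  match n with 0 => OT (opol x) 0 | 1 => OT 0 (oform x) | _ => 0 end.

Lemma ogpr_linear n : linear (ogpr n).
Proof.
by move=> a x y; case: n => [|[|n]]; apply: oeqP; rewrite /= ?scaler0 ?addr0.
Qed.
HB.instance Definition _ n :=
  GRing.isLinear.Build k H H *:%R (ogpr n) (ogpr_linear n).

Lemma ogpr_gpr m n x : ogpr m (ogpr n x) = if m == n then ogpr n x else 0.
Proof. by case: m => [|[|m]]; case: n => [|[|n]] //=; case: ifP. Qed.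

Lemma ogpr_sum x : exists N : nat, x = \sum_(n < N) ogpr n x.
Proof.
exists 2; rewrite big_ord_recl big_ord1.
by case: x => p q; apply: oeqP; rewrite /= ?addr0 ?add0r.
Qed.

Lemma ogprM m n x y : ogpr m x = x -> ogpr n y = y ->
  ogpr (m + n) (x * y) = x * y.
Proof.
case: m => [|[|m]]; case: n => [|[|n]] <- <-; rewrite ?addn0 ?mulr0 ?mul0r //=;
  rewrite ?linear0 //; apply: oeqP;
  by rewrite /= /oshift ?comp_poly0 ?mulr0 ?mul0r ?addr0.
Qed.

Definition otdt_ga : gradedAlg k := @GradedAlg k H (fun n => ogpr n)
  ogpr_gpr ogpr_sum (erefl _) ogprM.

Definition ot_ga : otdt_ga := ot.
Definition odt_ga : otdt_ga := odt.
Local Notation G := otdt_ga.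
Local Notation GG := (tens G G).
Local Notation t := ot_ga.
Local Notation dt := odt_ga.

(* left multiplication by Delta t = t ⊗ 1 + 1 ⊗ t, so that Delta p(t) is     *)
(* p(Delta t) (1 ⊗ 1) and Delta (p(t) dt) is p(Delta t) (dt ⊗ 1 + 1 ⊗ dt)    *)
Definition oL (u : GG) : GG :=
  tlift (fun x y => (t * x) ⊗ y + x ⊗ (t * y)) u.

Definition oLpoly (u : GG) (p : {poly k}) : GG :=
  \sum_(i < size p) p`_i *: iter i oL u.

Definition ocoprod (x : G) : GG :=
  oLpoly (1 ⊗ 1) (opol x) + oLpoly (dt ⊗ 1 + 1 ⊗ dt) (oform x).

Definition ocounit (x : G) : k^o := (opol x).[0].

(* the super-antihomomorphism with S t = - t and S dt = - dt *)
Definition oantipode (x : G) : G :=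
  OT (opol x \Po - 'X) (- (oform x \Po (- 'X - lam%:P))).

Lemma mul_lin (a : k) (x y z : G) : (a *: x + y) * z = a *: (x * z) + y * z.
Proof. by rewrite mulrDl scalerAl. Qed.
Lemma mul_linr (a : k) (x y z : G) : z * (a *: x + y) = a *: (z * x) + z * y.
Proof. by rewrite mulrDr scalerAr. Qed.

Lemma oL_bil : bilinear_for *:%R *:%R
  (fun x y : G => (t * x) ⊗ y + x ⊗ (t * y) : GG).
Proof.
apply: bilinearD; split=> [v|u] a x y /=; rewrite ?mul_linr ?ten_linl ?ten_linr //.
Qed.

Lemma oL_linear : linear oL.
Proof. exact: tlift_linear oL_bil. Qed.
HB.instance Definition _ := GRing.isLinear.Build k GG GG *:%R oL oL_linear.

Lemma oLE (x y : G) : oL (x ⊗ y) = (t * x) ⊗ y + x ⊗ (t * y).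
Proof. exact: tliftE oL_bil. Qed.

Definition oR (u : GG) : GG :=
  tlift (fun x y => (dt * x) ⊗ y + gsign 1 x ⊗ (dt * y)) u.

Lemma oR_bil : bilinear_for *:%R *:%R
  (fun x y : G => (dt * x) ⊗ y + gsign 1 x ⊗ (dt * y) : GG).
Proof.
apply: bilinearD; split=> [v|u] a x y /=;
  by rewrite ?gsign_lin ?mul_linr ?ten_linl ?ten_linr.
Qed.

Lemma oR_linear : linear oR.
Proof. exact: tlift_linear oR_bil. Qed.
HB.instance Definition _ := GRing.isLinear.Build k GG GG *:%R oR oR_linear.

Lemma tenZl a (x y : G) : (a *: x) ⊗ y = a *: (x ⊗ y).
Proof. exact: (linear_funZ _ _ (fun a b c => ten_linl a b c y)). Qed.
Lemma tenZr a (x y : G) : x ⊗ (a *: y) = a *: (x ⊗ y).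
Proof. exact: (linear_funZ _ _ (fun a b c => ten_linr a x b c)). Qed.
Lemma tenDl (x y z : G) : (x + y) ⊗ z = x ⊗ z + y ⊗ z.
Proof. exact: (linear_funD _ _ (fun a b c => ten_linl a b c z)). Qed.
Lemma tenDr (x y z : G) : z ⊗ (x + y) = z ⊗ x + z ⊗ y.
Proof. exact: (linear_funD _ _ (fun a b c => ten_linr a z b c)). Qed.

Lemma ten0l (x : G) : 0 ⊗ x = 0 :> GG.
Proof. exact: (linear_fun0 (fun a b c => ten_linl a b c x)). Qed.
Lemma ten0r (x : G) : x ⊗ 0 = 0 :> GG.
Proof. exact: (linear_fun0 (fun a b c => ten_linr a x b c)). Qed.

Lemma oRE m (x y : G) : homog m x ->
  oR (x ⊗ y) = (dt * x) ⊗ y + (-1) ^+ m *: (x ⊗ (dt * y)).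
Proof.
move=> hx; rewrite /oR (tliftE _ _ oR_bil) (gsignE _ hx) muln1.
by rewrite tenZl.
Qed.

Lemma homog_t : homog 0 t. Proof. exact: oeqP. Qed.
Lemma homog_dt : homog 1 dt. Proof. exact: oeqP. Qed.
Lemma homog_1 : homog 0 (1 : G). Proof. exact: gpr_1. Qed.

Lemma dt_t (x : G) : dt * (t * x) = t * (dt * x) + lam *: (dt * x).
Proof.
have e : dt * t = t * dt + lam *: dt.
  by rewrite -[lam *: dt]odt_t addrC subrK.
by rewrite !mulrA e mulrDl -scalerAl.
Qed.

Lemma oRL u : oR (oL u) = oL (oR u) + lam *: oR u.
Proof.
pose f u := oR (oL u); pose g u := oL (oR u) + lam *: oR u.
rewrite -/(f u) -/(g u); apply: tens_ext_homog => [a x y|a x y|m n x y hx hy].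
- by rewrite /f !linearP.
- by rewrite /g !linearP /= scalerDr addrACA !scalerA mulrC.
rewrite /f /g oLE (linear_funD _ _ oR_linear) (oRE _ hx).
rewrite (oRE _ (homogM homog_t hx)) add0n (oRE _ hx).
rewrite (linear_funD _ _ oL_linear) (linear_funZ _ _ oL_linear) !oLE !dt_t.
rewrite !tenDl !tenDr !tenZl !tenZr !scalerDr !scalerA [lam * _]mulrC !addrA.
by rewrite [LHS](ACl (1*4*3*5*2*6)).
Qed.

Lemma oLpoly_widen u (p : {poly k}) n : (size p <= n)%N ->
  oLpoly u p = \sum_(i < n) p`_i *: iter i oL u.
Proof.
move=> le; rewrite /oLpoly.
rewrite (big_ord_widen n (fun i => p`_i *: iter i oL u) le) big_mkcond /=.
apply: eq_bigr => i _; case: ltnP => // h.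
by rewrite nth_default ?scale0r.
Qed.

Lemma oLpoly_linear u : linear (oLpoly u).
Proof.
move=> a p q; pose n := maxn (size (a *: p + q)) (maxn (size p) (size q)).
rewrite (@oLpoly_widen _ (a *: p + q) n) ?leq_maxl //.
rewrite (@oLpoly_widen _ p n) ?(@oLpoly_widen _ q n) ?leq_max ?leqnn ?orbT //.
rewrite scaler_sumr -big_split; apply: eq_bigr => i _ /=.
by rewrite coefD coefZ scalerDl scalerA.
Qed.

Lemma oLpoly_mulX u p : oLpoly u ('X * p) = oL (oLpoly u p).
Proof.
rewrite -commr_polyX (@oLpoly_widen _ _ (size p).+1); last first.
  by rewrite (leq_trans (size_polyMleq _ _)) // size_polyX addn2.
rewrite big_ord_recl coefMX eqxx scale0r add0r /oLpoly.
rewrite (linear_fun_sum _ _ oL_linear); apply: eq_bigr => i _.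
by rewrite (linear_funZ _ _ oL_linear) coefMX.
Qed.

Lemma oLpoly1 u : oLpoly u 1 = u.
Proof. by rewrite /oLpoly size_poly1 big_ord1 coef1 scale1r. Qed.

Lemma ocoprod_linear : linear ocoprod.
Proof.
move=> a x y; rewrite /ocoprod.
rewrite -[opol _]/(a *: opol x + opol y) -[oform _]/(a *: oform x + oform y).
by rewrite !oLpoly_linear scalerDr addrACA.
Qed.
HB.instance Definition _ :=
  GRing.isLinear.Build k G GG *:%R ocoprod ocoprod_linear.

Lemma ocoprod1 : ocoprod 1 = 1 ⊗ 1.
Proof. by rewrite /ocoprod /= oLpoly1 (linear_fun0 (oLpoly_linear _)) addr0. Qed.

Lemma ocoprod_dt : ocoprod dt = dt ⊗ 1 + 1 ⊗ dt.
Proof. by rewrite /ocoprod /= oLpoly1 (linear_fun0 (oLpoly_linear _)) add0r. Qed.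

Lemma ocoprod_tM x : ocoprod (t * x) = oL (ocoprod x).
Proof.
rewrite /ocoprod -[opol _]/('X * opol x).
rewrite -[oform _]/('X * oform x + 0 * oshift (opol x)) mul0r addr0.
by rewrite !oLpoly_mulX (linear_funD _ _ oL_linear).
Qed.

Lemma ocoprod_t : ocoprod t = t ⊗ 1 + 1 ⊗ t.
Proof. by rewrite -[t in LHS]mulr1 ocoprod_tM ocoprod1 oLE !mulr1. Qed.

Lemma ocoprod_dtM x : ocoprod (dt * x) = oR (ocoprod x).
Proof.
have lz (z : G) : linear ( *%R z) by move=> a u v; apply: mul_linr.
apply: (otdt_ext (f := fun x : G => ocoprod (dt * x))
                 (g := fun x => oR (ocoprod x))) x.
- by move=> a x y; rewrite lz ocoprod_linear.
- by move=> a x y; rewrite ocoprod_linear oR_linear.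
- change (ocoprod (dt * 1) = oR (ocoprod 1)).
  rewrite mulr1 ocoprod_dt ocoprod1 (oRE _ homog_1).
  by rewrite expr0 scale1r !mulr1.
- change (ocoprod (dt * dt) = oR (ocoprod dt)).
  rewrite -[dt * dt]/(odt * odt) odt_dt (linear_fun0 ocoprod_linear).
  rewrite ocoprod_dt (linear_funD _ _ oR_linear) (oRE _ homog_1) (oRE _ homog_dt).
  rewrite -[dt * dt]/(odt * odt) odt_dt !mulr1 expr0 expr1 scale1r scaleN1r.
  by rewrite ten0l ten0r add0r addr0 addNr.
move=> x e; change (ocoprod (dt * (t * x)) = oR (ocoprod (t * x))).
rewrite dt_t (linear_funD _ _ ocoprod_linear).
by rewrite (linear_funZ _ _ ocoprod_linear) !ocoprod_tM e oRL.
Qed.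

Lemma smul_oL u v : smul (oL u) v = oL (smul u v).
Proof.
have L1 := (smul_bilinear G).1; have L2 := (smul_bilinear G).2.
apply: (tens_ext_homog (f := fun u => smul (oL u) v)
                       (g := fun u => oL (smul u v))) u => [a x y|a x y|m n x y hx hy].
- by rewrite oL_linear (L1 v).
- by rewrite (L1 v) oL_linear.
apply: (tens_ext_homog (f := fun v => smul (oL (x ⊗ y)) v)
                       (g := fun v => oL (smul (x ⊗ y) v))) v => [a u v|a u v|i j z w hz hw].
- exact: L2.
- by rewrite (L2 (x ⊗ y)) oL_linear.
rewrite oLE (linear_funD _ _ (L1 (z ⊗ w))) (smulE _ _ hy hz).
rewrite (smulE _ _ (homogM homog_t hy) hz) (smulE _ _ hy hz) add0n.
by rewrite (linear_funZ _ _ oL_linear) oLE scalerDr !mulrA.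
Qed.

Lemma smul_oR u v : smul (oR u) v = oR (smul u v).
Proof.
have L1 := (smul_bilinear G).1; have L2 := (smul_bilinear G).2.
apply: (tens_ext_homog (f := fun u => smul (oR u) v)
                       (g := fun u => oR (smul u v))) u => [a x y|a x y|m n x y hx hy].
- by rewrite oR_linear (L1 v).
- by rewrite (L1 v) oR_linear.
apply: (tens_ext_homog (f := fun v => smul (oR (x ⊗ y)) v)
                       (g := fun v => oR (smul (x ⊗ y) v))) v => [a u v|a u v|i j z w hz hw].
- exact: L2.
- by rewrite (L2 (x ⊗ y)) oR_linear.
rewrite (oRE _ hx) (linear_funD _ _ (L1 (z ⊗ w))) (linear_funZ _ _ (L1 (z ⊗ w))).
rewrite (smulE _ _ hy hz) (smulE _ _ (homogM homog_dt hy) hz) (smulE _ _ hy hz).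
rewrite (linear_funZ _ _ oR_linear) (oRE _ (homogM hx hz)) scalerDr !mulrA.
by congr (_ + _); rewrite !scalerA -!exprD mulnDl mul1n addnA addnC.
Qed.

Lemma ocoprodM x y : ocoprod (x * y) = smul (ocoprod x) (ocoprod y).
Proof.
have L1 := (smul_bilinear G).1; have L2 := (smul_bilinear G).2.
have one (v : GG) : smul (1 ⊗ 1) v = v.
  apply: (tens_ext_homog (f := fun v : GG => smul (1 ⊗ 1) v) (g := fun v => v)) v
    => [a u v|a u v|i j z w hz hw] //; first exact: L2.
  by rewrite (smulE _ _ homog_1 hz) expr0 scale1r !mul1r.
apply: (otdt_ext (f := fun x : G => ocoprod (x * y))
                 (g := fun x : G => smul (ocoprod x) (ocoprod y))) x.
- by move=> a u v; rewrite mul_lin ocoprod_linear.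
- by move=> a u v; rewrite ocoprod_linear (L1 _).
- change (ocoprod (1 * y) = smul (ocoprod 1) (ocoprod y)).
  by rewrite mul1r ocoprod1 one.
- change (ocoprod (dt * y) = smul (ocoprod dt) (ocoprod y)).
  rewrite ocoprod_dtM -[dt in RHS]mulr1 ocoprod_dtM ocoprod1 smul_oR.
  by rewrite one.
move=> x e; change (ocoprod (t * x * y) = smul (ocoprod (t * x)) (ocoprod y)).
by rewrite -mulrA !ocoprod_tM e smul_oL.
Qed.

(* coassociativity: both sides intertwine the left multiplications by t *)
Lemma ocoprodA h :
  tlift (fun x y => x ⊗ ocoprod y) (ocoprod h) =
  tlift (fun x y => tlift (fun a b => a ⊗ (b ⊗ y)) (ocoprod x)) (ocoprod h).
Proof.
pose T := tens G GG.
have bF : bilinear_for *:%R *:%R (fun x y : G => x ⊗ ocoprod y : T).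
  by split=> [v|u] a x y /=; rewrite ?ocoprod_linear ?ten_linl ?ten_linr.
have bA (y : G) : bilinear_for *:%R *:%R (fun a b : G => a ⊗ (b ⊗ y) : T).
  by split=> [v|u] a b c /=; rewrite !(ten_linl, ten_linr).
have lA := fun y => tlift_linear (bA y).
have bG : bilinear_for *:%R *:%R
    (fun x y : G => tlift (fun a b => a ⊗ (b ⊗ y) : T) (ocoprod x)).
  split=> [v|u] a x y /=; first by rewrite ocoprod_linear lA.
  apply: (@tlift_param _ G G G T (fun (y a b : G) => a ⊗ (b ⊗ y))) => z w c d e.
  by rewrite !ten_linr.
have lF := tlift_linear bF; have lG := tlift_linear bG.
have bL3 : bilinear_for *:%R *:%R
    (fun (x : G) (u : GG) => (t * x) ⊗ u + x ⊗ oL u : T).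
  apply: bilinearD; split=> [v|u] a x y /=;
    by rewrite ?mul_linr ?oL_linear ?ten_linl ?ten_linr.
pose L3 := tlift (fun (x : G) (u : GG) => (t * x) ⊗ u + x ⊗ oL u : T).
have lL3 : linear L3 := tlift_linear bL3.
have FL u : tlift (fun x y => x ⊗ ocoprod y) (oL u) =
            L3 (tlift (fun x y => x ⊗ ocoprod y) u).
  apply: (tens_ext (f := fun u => tlift (fun x y => x ⊗ ocoprod y) (oL u))
    (g := fun u => L3 (tlift (fun x y => x ⊗ ocoprod y) u))) u => [a x y|a x y|x y].
  - by rewrite oL_linear lF.
  - by rewrite lF lL3.
  rewrite oLE (linear_funD _ _ lF) !(tliftE _ _ bF) ocoprod_tM.
  by rewrite /L3 (tliftE _ _ bL3).
pose Gm := tlift (fun x y : G => tlift (fun a b => a ⊗ (b ⊗ y) : T) (ocoprod x)).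
have GL u : Gm (oL u) = L3 (Gm u).
  apply: (tens_ext (f := fun u => Gm (oL u)) (g := fun u => L3 (Gm u))) u
    => [a x y|a x y|x y].
  - by rewrite oL_linear /Gm lG.
  - by rewrite /Gm lG lL3.
  rewrite oLE /Gm (linear_funD _ _ lG) !(tliftE _ _ bG) ocoprod_tM.
  apply: (tens_ext (f := fun w : GG => tlift (fun a b => a ⊗ (b ⊗ y) : T) (oL w) +
     tlift (fun a b => a ⊗ (b ⊗ (t * y)) : T) w)
     (g := fun w => L3 (tlift (fun a b => a ⊗ (b ⊗ y) : T) w))) (ocoprod x)
     => [a v w|a v w|a b].
  - by rewrite oL_linear !lA scalerDr addrACA.
  - by rewrite lA lL3.
  rewrite oLE (linear_funD _ _ (lA y)) !(tliftE _ _ (bA _)) /L3 (tliftE _ _ bL3).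
  by rewrite oLE (linear_funD _ _ (fun e f g => ten_linr e a f g)) addrA.
rewrite -/(Gm _).
apply: (otdt_ext (f := fun h : G => tlift (fun x y => x ⊗ ocoprod y) (ocoprod h))
  (g := fun h : G => Gm (ocoprod h))) h.
- by move=> a u v; rewrite ocoprod_linear lF.
- by move=> a u v; rewrite ocoprod_linear /Gm lG.
- rewrite -[1]/(1 : G) ocoprod1 /Gm (tliftE _ _ bF) (tliftE _ _ bG) ocoprod1.
  by rewrite (tliftE _ _ (bA _)).
- change (tlift (fun x y => x ⊗ ocoprod y) (ocoprod dt) = Gm (ocoprod dt)).
  rewrite ocoprod_dt /Gm (linear_funD _ _ lF) (linear_funD _ _ lG).
  rewrite !(tliftE _ _ bF) !(tliftE _ _ bG) !ocoprod1 ocoprod_dt.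
  rewrite (linear_funD _ _ (lA 1)) !(tliftE _ _ (bA _)).
  by rewrite (linear_funD _ _ (fun e f g => ten_linr e 1 f g)) addrA.
move=> x e; change (tlift (fun x y => x ⊗ ocoprod y) (ocoprod (t * x)) =
  Gm (ocoprod (t * x))).
by rewrite ocoprod_tM FL GL e.
Qed.

Lemma ocounit_linear : linear ocounit.
Proof. move=> a x y; rewrite /ocounit -[opol _]/(a *: opol x + opol y).
by rewrite hornerD hornerZ. Qed.
HB.instance Definition _ :=
  GRing.isLinear.Build k G k^o *:%R ocounit ocounit_linear.

Lemma ocounit1 : ocounit 1 = 1.
Proof. by rewrite /ocounit /= hornerC. Qed.

Lemma ocounitM x y : ocounit (x * y) = (ocounit x : k) * ocounit y.
Proof. by rewrite /ocounit -hornerM. Qed.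

Lemma ocounit_t : ocounit t = 0. Proof. exact: hornerX. Qed.
Lemma ocounit_dt : ocounit dt = 0. Proof. exact: horner0. Qed.

Lemma ocounitl h : tlift (fun x y => (ocounit x : k) *: y) (ocoprod h) = h.
Proof.
have bf : bilinear_for *:%R *:%R (fun x y : G => (ocounit x : k) *: y).
  split=> [v|u] a x y /=; first by rewrite ocounit_linear scalerDl scalerA.
  by rewrite scalerDr !scalerA mulrC.
have lf := tlift_linear bf.
have fL u : tlift (fun x y => (ocounit x : k) *: y) (oL u) =
            t * tlift (fun x y => (ocounit x : k) *: y) u.
  apply: (tens_ext (f := fun u => tlift (fun x y : G => (ocounit x : k) *: y) (oL u))
    (g := fun u => t * tlift (fun x y : G => (ocounit x : k) *: y) u)) u
    => [a x y|a x y|x y].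
  - by rewrite oL_linear lf.
  - by rewrite lf mul_linr.
  rewrite oLE (linear_funD _ _ lf) !(tliftE _ _ bf) ocounitM ocounit_t mul0r.
  by rewrite scale0r add0r scalerAr.
apply: (otdt_ext (f := fun h : G => tlift (fun x y : G => (ocounit x : k) *: y)
  (ocoprod h)) (g := fun h : G => h)) h => //.
- by move=> a u v; rewrite ocoprod_linear lf.
- by rewrite -[1]/(1 : G) ocoprod1 (tliftE _ _ bf) ocounit1 scale1r.
- change (tlift (fun x y : G => (ocounit x : k) *: y) (ocoprod dt) = dt).
  rewrite ocoprod_dt (linear_funD _ _ lf) !(tliftE _ _ bf) ocounit1 ocounit_dt.
  by rewrite scale0r add0r scale1r.
move=> x e; change (tlift (fun x y : G => (ocounit x : k) *: y) (ocoprod (t * x)) =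
  t * x).
by rewrite ocoprod_tM fL e.
Qed.

Lemma ocounitr h : tlift (fun x y => (ocounit y : k) *: x) (ocoprod h) = h.
Proof.
have bf : bilinear_for *:%R *:%R (fun x y : G => (ocounit y : k) *: x).
  split=> [v|u] a x y /=; last by rewrite ocounit_linear scalerDl scalerA.
  by rewrite scalerDr !scalerA mulrC.
have lf := tlift_linear bf.
have fL u : tlift (fun x y => (ocounit y : k) *: x) (oL u) =
            t * tlift (fun x y => (ocounit y : k) *: x) u.
  apply: (tens_ext (f := fun u => tlift (fun x y : G => (ocounit y : k) *: x) (oL u))
    (g := fun u => t * tlift (fun x y : G => (ocounit y : k) *: x) u)) u
    => [a x y|a x y|x y].
  - by rewrite oL_linear lf.
  - by rewrite lf mul_linr.
  rewrite oLE (linear_funD _ _ lf) !(tliftE _ _ bf) ocounitM ocounit_t mul0r.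
  by rewrite scale0r addr0 scalerAr.
apply: (otdt_ext (f := fun h : G => tlift (fun x y : G => (ocounit y : k) *: x)
  (ocoprod h)) (g := fun h : G => h)) h => //.
- by move=> a u v; rewrite ocoprod_linear lf.
- by rewrite -[1]/(1 : G) ocoprod1 (tliftE _ _ bf) ocounit1 scale1r.
- change (tlift (fun x y : G => (ocounit y : k) *: x) (ocoprod dt) = dt).
  rewrite ocoprod_dt (linear_funD _ _ lf) !(tliftE _ _ bf) ocounit1 ocounit_dt.
  by rewrite scale0r addr0 scale1r.
move=> x e; change (tlift (fun x y : G => (ocounit y : k) *: x) (ocoprod (t * x)) =
  t * x).
by rewrite ocoprod_tM fL e.
Qed.

Lemma oantipode_linear : linear oantipode.
Proof.
move=> a x y; apply: oeqP; rewrite /= ?comp_polyD ?comp_polyZ //.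
by rewrite opprD scalerN.
Qed.
HB.instance Definition _ :=
  GRing.isLinear.Build k G G *:%R oantipode oantipode_linear.

Lemma oantipode_tM x : oantipode (t * x) = - (oantipode x * t).
Proof.
apply: oeqP; rewrite /= ?comp_polyM ?comp_polyX.
  by rewrite mulNr mulrC.
rewrite mul0r addr0 mulr0 add0r comp_polyM comp_polyX oshiftX.
by rewrite -opprD !mulNr !opprK mulrC.
Qed.

Lemma oantipode1 : oantipode 1 = 1.
Proof.
by apply: oeqP; rewrite /= ?comp_poly0 ?oppr0 // -[1]/(1%:P) comp_polyC.
Qed.

Lemma oantipode_dt : oantipode dt = - dt.
Proof.
apply: oeqP; rewrite /= ?comp_poly0 ?oppr0 //.
by rewrite -[X in X \Po _]/(1%:P) comp_polyC.
Qed.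

Lemma oantipodel h :
  tlift (fun x y => oantipode x * y) (ocoprod h) = (ocounit h : k)%:A.
Proof.
pose F := fun x y : G => oantipode x * y.
have bf : bilinear_for *:%R *:%R F.
  by split=> [v|u] a x y; rewrite /F ?oantipode_linear ?mul_lin ?mul_linr.
have lf := tlift_linear bf.
have fL u : tlift F (oL u) = 0.
  apply: (tens_ext (f := fun u => tlift F (oL u)) (g := fun u => 0)) u
    => [a x y|a x y|x y].
  - by rewrite oL_linear lf.
  - by rewrite scaler0 addr0.
  rewrite oLE (linear_funD _ _ lf) !(tliftE _ _ bf) /F oantipode_tM.
  by rewrite mulNr mulrA addNr.
rewrite -/F; apply: (otdt_ext (f := fun h : G => tlift F (ocoprod h))
  (g := fun h : G => (ocounit h : k)%:A : G)) h.
- by move=> a u v; rewrite ocoprod_linear lf.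
- by move=> a u v; rewrite ocounit_linear scalerDl scalerA.
- by rewrite -[1]/(1 : G) ocoprod1 (tliftE _ _ bf) /F oantipode1 ocounit1
     mulr1 scale1r.
- change (tlift F (ocoprod dt) = (ocounit dt : k)%:A).
  rewrite ocoprod_dt (linear_funD _ _ lf) !(tliftE _ _ bf) /F ocounit_dt.
  by rewrite oantipode1 oantipode_dt mulr1 mul1r addNr scale0r.
move=> x e; change (tlift F (ocoprod (t * x)) = (ocounit (t * x) : k)%:A).
by rewrite ocoprod_tM fL ocounitM ocounit_t mul0r scale0r.
Qed.

Lemma oantipoder h :
  tlift (fun x y => x * oantipode y) (ocoprod h) = (ocounit h : k)%:A.
Proof.
pose F := fun x y : G => x * oantipode y.
have bf : bilinear_for *:%R *:%R F.
  by split=> [v|u] a x y; rewrite /F ?oantipode_linear ?mul_lin ?mul_linr.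
have lf := tlift_linear bf.
have fL u : tlift F (oL u) = t * tlift F u - tlift F u * t.
  apply: (tens_ext (f := fun u => tlift F (oL u))
    (g := fun u => t * tlift F u - tlift F u * t)) u => [a x y|a x y|x y].
  - by rewrite oL_linear lf.
  - by rewrite lf mul_lin mul_linr opprD addrACA scalerBr.
  rewrite oLE (linear_funD _ _ lf) !(tliftE _ _ bf) /F oantipode_tM.
  by rewrite mulrN !mulrA.
rewrite -/F; apply: (otdt_ext (f := fun h : G => tlift F (ocoprod h))
  (g := fun h : G => (ocounit h : k)%:A : G)) h.
- by move=> a u v; rewrite ocoprod_linear lf.
- by move=> a u v; rewrite ocounit_linear scalerDl scalerA.
- by rewrite -[1]/(1 : G) ocoprod1 (tliftE _ _ bf) /F oantipode1 ocounit1
     mulr1 scale1r.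
- change (tlift F (ocoprod dt) = (ocounit dt : k)%:A).
  rewrite ocoprod_dt (linear_funD _ _ lf) !(tliftE _ _ bf) /F ocounit_dt.
  by rewrite oantipode1 oantipode_dt mulr1 mul1r subrr scale0r.
move=> x e; change (tlift F (ocoprod (t * x)) = (ocounit (t * x) : k)%:A).
have e' : tlift F (ocoprod x) = (ocounit x : k)%:A by [].
rewrite ocoprod_tM fL e' ocounitM ocounit_t mul0r scale0r.
by rewrite -scalerAl -scalerAr mul1r mulr1 subrr.
Qed.

Lemma thomog_lin n a (u v : GG) : thomog n u -> thomog n v -> thomog n (a *: u + v).
Proof.
move=> [s [-> hs]] [r [-> hr]].
exists ([seq (a *: p.1, p.2) | p <- s] ++ r); split.
  rewrite big_cat big_map scaler_sumr; congr (_ + _).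
  by apply: eq_bigr => p _; rewrite tenZl.
move=> p; rewrite mem_cat => /orP[/mapP[q qs ->]|]; last exact: hr.
have [i [j [h1 h2 e]]] := hs q qs; exists i, j; split=> //=.
by rewrite /homog linearZ h1.
Qed.

Lemma thomog_ten i j (x y : G) : homog i x -> homog j y -> thomog (i + j) (x ⊗ y).
Proof.
move=> hx hy; exists [:: (x, y)]; rewrite big_seq1; split=> // p.
by rewrite inE => /eqP ->; exists i, j.
Qed.

Lemma thomogD n (u v : GG) : thomog n u -> thomog n v -> thomog n (u + v).
Proof. by move=> hu hv; rewrite -[u]scale1r; apply: thomog_lin. Qed.

Lemma thomog0 n : thomog n (0 : GG).
Proof. by exists [::]; rewrite big_nil. Qed.

Lemma thomog_sum n (s : seq (G * G)) (F : G * G -> GG) :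
  (forall p, p \in s -> thomog n (F p)) -> thomog n (\sum_(p <- s) F p).
Proof.
elim: s => [|p s ih] h; first by rewrite big_nil; apply: thomog0.
rewrite big_cons; apply: thomogD; first by apply: h; rewrite inE eqxx.
by apply: ih => q hq; apply: h; rewrite inE hq orbT.
Qed.

Lemma thomog_oL n (u : GG) : thomog n u -> thomog n (oL u).
Proof.
move=> [s [-> hs]]; rewrite (linear_fun_sum _ _ oL_linear).
apply: thomog_sum => p ps; have [i [j [h1 h2 <-]]] := hs p ps.
rewrite oLE; apply: thomogD; apply: thomog_ten => //.
  exact: homogM homog_t h1.
exact: homogM homog_t h2.
Qed.

Lemma thomog_oLpoly n (u : GG) p : thomog n u -> thomog n (oLpoly u p).
Proof.
move=> hu; have hi i : thomog n (iter i oL u).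
  by elim: i => //= i ih; apply: thomog_oL.
rewrite /oLpoly; elim: (size p) => [|m ih].
  by rewrite big_ord0; apply: thomog0.
by rewrite big_ord_recr /= addrC; apply: thomog_lin.
Qed.

Lemma ocoprod_deg n (h : G) : homog n h -> thomog n (ocoprod h).
Proof.
have d1 : thomog 1 (dt ⊗ 1 + 1 ⊗ dt : GG).
  apply: thomogD; first exact: (thomog_ten homog_dt homog_1).
  exact: (thomog_ten homog_1 homog_dt).
case: n => [|[|n]] <-; rewrite /ocoprod /=.
- rewrite (linear_fun0 (oLpoly_linear _)) addr0; apply: thomog_oLpoly.
  exact: (thomog_ten homog_1 homog_1).
- by rewrite (linear_fun0 (oLpoly_linear _)) add0r; apply: thomog_oLpoly.
rewrite !(linear_fun0 (oLpoly_linear _)) addr0; exact: thomog0.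
Qed.

Lemma ocounit_deg n (h : G) : homog n h -> n != 0%N -> ocounit h = 0.
Proof. by case: n => [|[|n]] // <- _; rewrite /ocounit /= horner0. Qed.

Lemma oantipode_deg n (h : G) : homog n h -> homog n (oantipode h).
Proof.
case: n => [|[|n]] <-; apply: oeqP; rewrite /= ?comp_poly0 ?oppr0 //.
Qed.

Definition otdt_hopf : superHopf k := @SuperHopf k G ocoprod ocounit oantipode
  ocoprod_deg ocounit_deg oantipode_deg ocoprodA ocounitl ocounitr
  ocoprod1 ocoprodM ocounit1 ocounitM oantipodel oantipoder.

Definition oin (p : {poly k}) : G := OT p 0.

Lemma oin_linear : linear oin.
Proof. by move=> a p q; apply: oeqP; rewrite /= ?scaler0 ?addr0. Qed.
HB.instance Definition _ :=
  GRing.isLinear.Build k {poly k} G *:%R oin oin_linear.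

Lemma oin_monoid : monoid_morphism oin.
Proof. by split=> // p q; apply: oeqP; rewrite /= ?mulr0 ?mul0r ?addr0. Qed.
HB.instance Definition _ := GRing.isMonoidMorphism.Build {poly k} G oin oin_monoid.

Lemma oin_inj : injective oin. Proof. by move=> p q []. Qed.

Lemma odeg0 (w : G) : homog 0 w <-> exists p, w = oin p.
Proof. by split=> [<-|[p ->]]; [exists (opol w) | apply: oeqP]. Qed.

(* d p(t) = lam^-1 (p(t + lam) - p(t)) dt, which is [dt, p(t)] up to lam *)
Definition od (x : G) : G := OT 0 (lam^-1 *: (oshift (opol x) - opol x)).

Lemma od_linear : linear od.
Proof.
move=> a x y; apply: oeqP; rewrite /= ?scaler0 ?addr0 //.
by rewrite oshiftD oshiftZ opprD addrACA -scalerBr scalerDr !scalerA mulrC.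
Qed.
HB.instance Definition _ := GRing.isLinear.Build k G G *:%R od od_linear.

Lemma oshift0 : oshift 0 = 0. Proof. exact: comp_poly0. Qed.

Lemma od_deg n (w : G) : homog n w -> homog n.+1 (od w).
Proof.
case: n => [|[|n]] <-; apply: oeqP => //=;
  by rewrite oshift0 subrr scaler0.
Qed.

Lemma odM n (v w : G) : homog n v ->
  od (v * w) = od v * w + (-1) ^+ n *: (v * od w).
Proof.
case: n => [|[|n]] <-; apply: oeqP;
  rewrite /= ?mul0r ?mulr0 ?addr0 ?add0r ?scaler0 ?oshift0 ?subrr ?scaler0
    ?mul0r ?mulr0 ?addr0 ?oshift0 ?mulr0 //; last by rewrite scaler0 addr0.
rewrite scale1r oshiftM -!scalerAl -scalerAr -scalerDr; congr (_ *: _).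
by rewrite mulrBl mulrBr addrA subrK.
Qed.

Lemma od_od (w : G) : od (od w) = 0.
Proof. by apply: oeqP; rewrite /= ?oshift0 ?subrr ?scaler0. Qed.

Definition otdt_dga : dga {poly k} := @Dga k _ G oin oin_inj odeg0 od od_deg odM od_od.

Lemma od_t : lam != 0 -> od t = dt.
Proof.
move=> l0; apply: oeqP => //=; rewrite oshiftX addrAC subrr add0r.
by rewrite -alg_polyC scalerA mulVf ?scale1r.
Qed.

End OmegaTDt.

(* Main.v *)
Require Import Defs.
From HB Require Import structures.
From mathcomp Require Import all_boot all_order all_algebra.
From mathcomp Require Import boolp.

Set Implicit Arguments.
Unset Strict Implicit.
Unset Printing Implicit Defensive.

Import GRing.Theory.
Local Open Scope ring_scope.

(* Let t act on Omega(A) as lam (tau - degree), an even derivation, and dt as *)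
(* lam d, an odd one. Since d raises the degree by one and commutes with tau, *)
(* these operators satisfy [dt, t] = lam dt and dt dt = 0, hence define an    *)
(* action of Omega(t, dt); the module algebra axioms are the Leibniz rules.   *)
(* On Omega(A) ⊗ Omega(t, dt) left multiplication by t and dt is prescribed   *)
(* by the coproduct, and these two operators satisfy the same relations, so   *)
(* that Omega(t, dt) acts there too; composing with multiplication by         *)
(* Omega(A) gives the semidirect product. There theta = lam^-1 dt has square  *)
(* zero, so that the graded commutator with theta is a differential; it       *)
(* restricts to the given ones on the two factors. Killing Omega(A)^n for     *)
(* n > 0 and dt identifies the universal property of the degree zero part     *)
(* with that of A_t.                                                          *)

(** By its presentation, a module over Omega(t, dt) is a vector space with operators T and E such
    that E T - T E = lam E and E E = 0 ([otdt_module]). On Omega(A) take T = lam (tau - degree) and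
    E = lam d. Since d commutes with tau and raises the degree by one, the first relation holds, and
    d d = 0 gives the second ([tau_module]). T is an even derivation and E an odd one; as t and dt
    are primitive, this is what a super-module algebra requires ([ta_super_module_algebra]).

    The product on Omega(A) ⊗ Omega(t, dt) is built from operators: left multiplication by t is T ⊗
    1 + 1 ⊗ t and by dt is E ⊗ 1 + sigma ⊗ dt, with sigma the parity automorphism. They satisfy the
    same relations ([smash_module]), so associativity reduces to generators ([smash_mulA]), and the
    coproduct formula is recovered afterwards ([smash_in_mul]). Throughout, [otdt_ext] reduces an
    identity linear in h to h = 1, h = dt and compatibility with left multiplication by t.

    In this algebra dt w - sigma(w) dt = lam d w, and theta = lam^-1 dt has square zero, so the
    graded commutator with theta is a differential ([inner_dga_of]). It extends d on Omega(A)
    ([tau_dga_base]) and on Omega(t, dt) ([tau_dga_otdt]). The degree-zero part is A_t: a map on A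
    together with an image of t extends to the whole algebra by sending the positive degrees of
    Omega(A) and dt to zero ([smash_universal], [tau_generated]). *)

Section Tensors.
Context {k : fieldType} {U V : lmodType k}.
Implicit Types (u : U) (v : V).

Lemma tensDl u1 u2 v : (u1 + u2) ⊗ v = u1 ⊗ v + u2 ⊗ v.
Proof. exact: (linear_funD _ _ (fun a b c => ten_linl a b c v)). Qed.
Lemma tensDr u v1 v2 : u ⊗ (v1 + v2) = u ⊗ v1 + u ⊗ v2.
Proof. exact: (linear_funD _ _ (fun a b c => ten_linr a u b c)). Qed.
Lemma tensZl a u v : (a *: u) ⊗ v = a *: (u ⊗ v).
Proof. exact: (linear_funZ _ _ (fun a b c => ten_linl a b c v)). Qed.
Lemma tensZr a u v : u ⊗ (a *: v) = a *: (u ⊗ v).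
Proof. exact: (linear_funZ _ _ (fun a b c => ten_linr a u b c)). Qed.
Lemma tens0l v : (0 : U) ⊗ v = 0.
Proof. exact: (linear_fun0 (fun a b c => ten_linl a b c v)). Qed.
Lemma tens0r u : u ⊗ (0 : V) = 0.
Proof. exact: (linear_fun0 (fun a b c => ten_linr a u b c)). Qed.

Lemma tens_ind (P : tens U V -> Prop) :
  (forall a x y, P x -> P y -> P (a *: x + y)) -> (forall u v, P (u ⊗ v)) ->
  forall x, P x.
Proof.
move=> Plin Pten x; have [s ->] := tens_sum x.
elim: s => [|p s ih].
  by rewrite big_nil -(addNr (0 ⊗ 0)) -scaleN1r; apply: Plin.
by rewrite big_cons -[_ ⊗ _]scale1r; apply: Plin.
Qed.

Lemma tlift_ten (x : tens U V) : tlift (@ten k U V) x = x.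
Proof.
have bt := ten_bilinear U V.
by elim/tens_ind: x => [a x y hx hy|u v]; rewrite ?tliftE // tlift_linear // hx hy.
Qed.

End Tensors.

(** * Homogeneous components, parity and degree operators *)

Section Graded.
Context {k : fieldType}.
Implicit Types G B C : gradedAlg k.

Lemma gpr_homog G n (x : G) : homog n (gpr G n x).
Proof. by rewrite /homog gpr_gpr eqxx. Qed.

Lemma gprE G m n (x : G) : homog m x -> gpr G n x = if n == m then x else 0.
Proof. by move=> hx; rewrite -{1}hx gpr_gpr; case: eqP => // ->. Qed.

Lemma homog0 G n : homog n (0 : G). Proof. exact: linear0. Qed.
Lemma homogZ G n a (x : G) : homog n x -> homog n (a *: x).
Proof. by move=> hx; rewrite /homog linearZ hx. Qed.
Lemma homogD G n (x y : G) : homog n x -> homog n y -> homog n (x + y).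
Proof. by move=> hx hy; rewrite /homog linearD hx hy. Qed.

Lemma graded_ext G (M : lmodType k) (f g : G -> M) : linear f -> linear g ->
  (forall n x, homog n x -> f x = g x) -> f =1 g.
Proof.
move=> lf lg h x; have [N ->] := gpr_sum x.
rewrite !linear_fun_sum //; apply: eq_bigr => i _; apply: h; exact: gpr_homog.
Qed.

(** Degrees are nonnegative, so m + n = 0 only for m = n = 0. This makes the projection to degree
    zero an algebra map. *)
Lemma gpr0M G (x y : G) : gpr G 0 (x * y) = gpr G 0 x * gpr G 0 y.
Proof.
apply: (graded_ext (f := fun x => gpr G 0 (x * y))
  (g := fun x => gpr G 0 x * gpr G 0 y)) x => [a u v|a u v|m x hx].
- by rewrite mulrDl -scalerAl linearP.
- by rewrite linearP mulrDl -scalerAl.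
apply: (graded_ext (f := fun y => gpr G 0 (x * y))
  (g := fun y => gpr G 0 x * gpr G 0 y)) y => [a u v|a u v|n y hy].
- by rewrite mulrDr -scalerAr linearP.
- by rewrite linearP mulrDr -scalerAr.
rewrite (gprE _ hx) (gprE _ hy) (gprE _ (homogM hx hy)).
by case: m n {hx hy} => [|m] [|n]; rewrite ?mul0r ?mulr0.
Qed.

Lemma gsign_homog G n m (x : G) : homog m x -> homog m (gsign n x).
Proof. by move=> hx; rewrite (gsignE _ hx); apply: homogZ. Qed.

Lemma gsign1 G n : gsign n (1 : G) = 1.
Proof. by rewrite (gsignE _ (gpr_1 G)) mul0n scale1r. Qed.

(** [gsign n] is the n-th power of the parity automorphism: its sign is multiplicative in the
    degree. *)
Lemma gsignM G n (x y : G) : gsign n (x * y) = gsign n x * gsign n y.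
Proof.
have lg := @gsign_linear k G n.
apply: (graded_ext (f := fun x => gsign n (x * y))
  (g := fun x => gsign n x * gsign n y)) x => [a u v|a u v|m x hx].
- by rewrite mulrDl -scalerAl lg.
- by rewrite lg mulrDl -scalerAl.
apply: (graded_ext (f := fun y => gsign n (x * y))
  (g := fun y => gsign n x * gsign n y)) y => [a u v|a u v|l y hy].
- by rewrite mulrDr -scalerAr lg.
- by rewrite lg mulrDr -scalerAr.
rewrite (gsignE _ hx) (gsignE _ hy) (gsignE _ (homogM hx hy)).
by rewrite -scalerAl -scalerAr scalerA -exprD mulnDl.
Qed.

Lemma gsign_gsign G m n (x : G) : gsign m (gsign n x) = gsign (m + n) x.
Proof.
have lg l := @gsign_linear k G l.
apply: (graded_ext (f := fun x => gsign m (gsign n x)) (g := gsign (m + n))) x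
  => [a u v||l x hx]; rewrite ?lg //.
rewrite (gsignE _ hx) (gsignE _ (homogZ _ hx)) (gsignE _ hx) scalerA -exprD.
by rewrite mulnDr.
Qed.

Lemma gsign2 G (x : G) : gsign 2 x = x.
Proof.
have lg := @gsign_linear k G 2.
apply: (graded_ext (f := gsign 2) (g := id)) x => // l x hx.
by rewrite (gsignE _ hx) mulnC exprM sqrrN !expr1n scale1r.
Qed.

(** The degree derivation (Euler operator), extended linearly to inhomogeneous elements. *)
Definition gdegmul G (x : G) : G := gsum (fun n xn => xn *+ n) x.

Lemma gdegmul_linear G : linear (@gdegmul G).
Proof. by apply: gsum_linear => n a x y; rewrite mulrnDl scalerMnr. Qed.

Lemma gdegmulE G n (x : G) : homog n x -> gdegmul x = x *+ n.
Proof. by move=> hx; rewrite /gdegmul (gsum_homog _ hx) // => i; rewrite mul0rn. Qed.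

End Graded.

(** * The total grading of a tensor product *)

Section TensorGrading.
Context {k : fieldType} {B C : gradedAlg k}.

Lemma tens_homog_ind (P : tens B C -> Prop) :
  (forall a x y, P x -> P y -> P (a *: x + y)) ->
  (forall m n (b : B) (c : C), homog m b -> homog n c -> P (b ⊗ c)) ->
  forall x, P x.
Proof.
move=> Plin Pten; apply: tens_ind => // b c.
have P0 : P 0 by rewrite -(tens0l (0 : C)); apply: (Pten 0%N 0%N 0 0); apply: homog0.
have Psum (I : Type) (s : seq I) (F : I -> tens B C) :
    (forall i, P (F i)) -> P (\sum_(i <- s) F i).
  move=> PF; elim: s => [|i s ih]; first by rewrite big_nil.
  by rewrite big_cons -[F i]scale1r; apply: Plin.
have [N ->] := gpr_sum b; have [N' ->] := gpr_sum c.
rewrite (linear_fun_sum _ _ (fun a x y => ten_linl a x y _)); apply: (Psum) => i.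
rewrite (linear_fun_sum _ _ (fun a x y => ten_linr a _ x y)); apply: (Psum) => j.
by apply: Pten; apply: gpr_homog.
Qed.

Definition tpr (n : nat) (u : tens B C) : tens B C :=
  tlift (fun b c => \sum_(i < n.+1) gpr B i b ⊗ gpr C (n - i) c) u.

Lemma tpr_bil n : bilinear_for *:%R *:%R
  (fun (b : B) (c : C) => \sum_(i < n.+1) gpr B i b ⊗ gpr C (n - i) c).
Proof.
split=> [c|b] a x y /=; rewrite scaler_sumr -big_split; apply: eq_bigr => i _ /=;
  by rewrite linearP (ten_linl, ten_linr).
Qed.

Lemma tpr_linear n : linear (tpr n).
Proof. exact: tlift_linear (tpr_bil n). Qed.
HB.instance Definition _ n :=
  GRing.isLinear.Build k (tens B C) (tens B C) *:%R (tpr n) (tpr_linear n).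

Lemma tprE l m n (b : B) (c : C) : homog m b -> homog n c ->
  tpr l (b ⊗ c) = if l == (m + n)%N then b ⊗ c else 0.
Proof.
move=> hb hc; rewrite /tpr (tliftE _ _ (tpr_bil l)).
have e (i : 'I_l.+1) : gpr B i b ⊗ gpr C (l - i) c =
    if (i == m :> nat) && (l == (m + n)%N) then b ⊗ c else 0.
  rewrite (gprE _ hb) (gprE _ hc); case: (i =P m :> nat) => [<-|_] /=; last exact: tens0l.
  (* The truncated difference [l - i] is exact, since i is at most l. *)
  rewrite -(eqn_add2l i) subnKC; last by rewrite -ltnS.
  by case: ifP => // _; apply: tens0r.
rewrite (eq_bigr _ (fun i _ => e i)).
case: (l =P (m + n)%N) => [->|_]; last by rewrite big1 // => i _; rewrite andbF.
have lm : (m < (m + n).+1)%N by rewrite ltnS leq_addr.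
rewrite (bigD1 (Ordinal lm)) //= eqxx big1 ?addr0 // => i.
by rewrite -val_eqE /= => /negPf ->.
Qed.

Lemma tpr_tpr m n x : tpr m (tpr n x) = if m == n then tpr n x else 0.
Proof.
elim/tens_homog_ind: x => [a x y hx hy|i j b c hb hc].
  by rewrite !linearP /= hx hy; case: ifP => // _; rewrite scaler0 addr0.
rewrite (tprE n hb hc); case: (n =P (i + j)%N) => [->|_].
  by rewrite (tprE m hb hc).
by rewrite linear0; case: ifP.
Qed.

Lemma tpr_sum x : exists N : nat, x = \sum_(n < N) tpr n x.
Proof.
(* Asking for every larger bound lets linear combinations use the maximum of two bounds. *)
suff [N h] : exists N : nat, forall N', (N <= N')%N -> x = \sum_(n < N') tpr n x.
  by exists N; apply: h.
elim/tens_homog_ind: x => [a x y [N hx] [N' hy]|i j b c hb hc].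
  exists (maxn N N') => L; rewrite geq_max => /andP[hN hN'].
  rewrite {1}(hx L hN) {1}(hy L hN') scaler_sumr -big_split.
  by apply: eq_bigr => n _; rewrite linearP.
exists (i + j).+1 => L lt; rewrite (bigD1 (Ordinal lt)) //= (tprE _ hb hc) eqxx.
rewrite big1 ?addr0 // => n; rewrite -val_eqE (tprE _ hb hc) /= => /negPf ->.
by [].
Qed.

End TensorGrading.

(** * Modules over Omega(t, dt) as pairs of operators *)

Record otdt_module (k : fieldType) (lam : k) (M : lmodType k) (T E : M -> M) : Prop :=
  OtdtModule {
    om_T : linear T;
    om_E : linear E;
    om_ET : forall x, E (T x) = T (E x) + lam *: E x;
    om_EE : forall x, E (E x) = 0 }.

Section OtdtModule.
Context {k : fieldType} {lam : k} {M : lmodType k} {T E : M -> M}.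

Definition polyact (p : {poly k}) (x : M) : M := \sum_(i < size p) p`_i *: iter i T x.

Context (modM : otdt_module lam T E).
Let lT := om_T modM.
Let lE := om_E modM.

(** The normal form p(t) + q(t) dt acts as p(T) + q(T) E. *)
Definition otdt_act (h : otdt lam) (x : M) : M :=
  polyact (opol h) x + polyact (oform h) (E x).

Lemma polyact_widen (p : {poly k}) n x : (size p <= n)%N ->
  polyact p x = \sum_(i < n) p`_i *: iter i T x.
Proof.
move=> le; rewrite /polyact (big_ord_widen n (fun i => p`_i *: iter i T x) le).
rewrite big_mkcond /=; apply: eq_bigr => i _; case: ltnP => // h.
by rewrite nth_default ?scale0r.
Qed.

Lemma polyact_linearl x : linear (fun p => polyact p x).
Proof.
move=> a p q; pose n := maxn (size (a *: p + q)) (maxn (size p) (size q)).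
rewrite (@polyact_widen (a *: p + q) n) ?leq_maxl //.
rewrite (@polyact_widen p n) ?(@polyact_widen q n) ?leq_max ?leqnn ?orbT //.
rewrite scaler_sumr -big_split; apply: eq_bigr => i _ /=.
by rewrite coefD coefZ scalerDl scalerA.
Qed.

Lemma polyact_linearr p : linear (polyact p).
Proof.
move=> a x y; rewrite /polyact scaler_sumr -big_split; apply: eq_bigr => i _ /=.
have -> : iter i T (a *: x + y) = a *: iter i T x + iter i T y.
  by elim: (nat_of_ord i) => //= n ->; rewrite lT.
by rewrite scalerDr !scalerA mulrC.
Qed.

Lemma polyact_mulX p x : polyact ('X * p) x = T (polyact p x).
Proof.
(* This bound also covers p = 0, where [p * 'X] has size 0. *)
rewrite -commr_polyX (@polyact_widen _ (size p).+1); last first.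
  by rewrite (leq_trans (size_polyMleq _ _)) // size_polyX addn2.
rewrite big_ord_recl coefMX eqxx scale0r add0r /polyact (linear_fun_sum _ _ lT).
by apply: eq_bigr => i _; rewrite (linear_funZ _ _ lT) coefMX.
Qed.

Lemma polyact1 x : polyact 1 x = x.
Proof. by rewrite /polyact size_poly1 big_ord1 coef1 scale1r. Qed.

Lemma polyact0 x : polyact 0 x = 0.
Proof. exact: linear_fun0 (polyact_linearl x). Qed.

Lemma otdt_act_bil : bilinear_for *:%R *:%R otdt_act.
Proof.
split=> [x|h] a b c; rewrite /otdt_act /= ?lE !(polyact_linearl, polyact_linearr);
  by rewrite scalerDr addrACA.
Qed.

Lemma otdt_act1 x : otdt_act 1 x = x.
Proof. by rewrite /otdt_act /= polyact1 polyact0 addr0. Qed.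

Lemma otdt_act_dt x : otdt_act (odt lam) x = E x.
Proof. by rewrite /otdt_act /= polyact1 polyact0 add0r. Qed.

Lemma otdt_act_tM h x : otdt_act (ot lam * h) x = T (otdt_act h x).
Proof.
by rewrite /otdt_act /= mul0r addr0 !polyact_mulX (linear_funD _ _ lT).
Qed.

Lemma otdt_act_t x : otdt_act (ot lam) x = T x.
Proof. by rewrite -[ot lam]mulr1 otdt_act_tM otdt_act1. Qed.

(** Here the relations between T and E enter: E E = 0 settles h = dt, and the commutation of E with
    T matches that of dt with t in the inductive step. *)
Lemma otdt_act_dtM h x : otdt_act (odt lam * h) x = E (otdt_act h x).
Proof.
have lz (z : otdt lam) : linear ( *%R z) by move=> a u v; rewrite mulrDr scalerAr.
apply: (otdt_ext (f := fun h : otdt lam => otdt_act (odt lam * h) x)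
  (g := fun h => E (otdt_act h x))) h => [a u v|a u v|||h e].
- by rewrite lz (otdt_act_bil.1 x).
- by rewrite (otdt_act_bil.1 x) lE.
- by rewrite mulr1 otdt_act1 otdt_act_dt.
- by rewrite odt_dt (linear_fun0 (otdt_act_bil.1 x)) otdt_act_dt (om_EE modM).
have -> : odt lam * (ot lam * h) = lam *: (odt lam * h) + ot lam * (odt lam * h).
  by rewrite scalerAl -odt_t mulrBl !mulrA subrK.
by rewrite (otdt_act_bil.1 x) !otdt_act_tM e (om_ET modM) addrC.
Qed.

Lemma otdt_actM g h x : otdt_act (g * h) x = otdt_act g (otdt_act h x).
Proof.
apply: (otdt_ext (f := fun g : otdt lam => otdt_act (g * h) x)
  (g := fun g => otdt_act g (otdt_act h x))) g => [a u v|a u v|||g e].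
- by rewrite mulrDl -scalerAl (otdt_act_bil.1 x).
- by rewrite (otdt_act_bil.1 _).
- by rewrite mul1r otdt_act1.
- by rewrite otdt_act_dtM otdt_act_dt.
by rewrite -mulrA !otdt_act_tM e.
Qed.

(** The degree is an abstract predicate so that the lemma serves both Omega(A) and the semidirect
    product, whose graded algebra structure is only being built when it is applied. *)
Lemma otdt_act_deg (deg : nat -> M -> Prop) m n (h : otdt_ga lam) x :
  (forall i, deg i 0) ->
  (forall i a y z, deg i y -> deg i z -> deg i (a *: y + z)) ->
  (forall i y, deg i y -> deg i (T y)) -> (forall i y, deg i y -> deg i.+1 (E y)) ->
  homog m h -> deg n x -> deg (m + n)%N (otdt_act h x).
Proof.
move=> deg0 deg_lin degT degE hh hx.
have degP i p y : deg i y -> deg i (polyact p y).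
  move=> hy; have hi l : deg i (iter l T y) by elim: l => //= l; apply: degT.
  rewrite /polyact; elim: (size p) => [|l ih]; first by rewrite big_ord0.
  by rewrite big_ord_recr /= addrC; apply: deg_lin.
case: m hh => [|[|m]] <-; rewrite /otdt_act /= !polyact0 ?addr0 ?add0r //.
  exact: degP.
by apply: degP; apply: degE.
Qed.

End OtdtModule.


Arguments polyact {k M} T p x.
Arguments otdt_act {k lam M} T E h x.

(** * Super-module algebras from an even and an odd derivation *)

Record tdtAction (k : fieldType) (lam : k) := TdtAction {
  ta_alg :> gradedAlg k;
  ta_t : ta_alg -> ta_alg;
  ta_dt : ta_alg -> ta_alg;
  ta_module : otdt_module lam ta_t ta_dt;
  ta_t_deg : forall n b, homog n b -> homog n (ta_t b);
  ta_dt_deg : forall n b, homog n b -> homog n.+1 (ta_dt b);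
  ta_tM : forall b c, ta_t (b * c) = ta_t b * c + b * ta_t c;
  ta_dtM : forall b c, ta_dt (b * c) = ta_dt b * c + gsign 1 b * ta_dt c }.

Section Smash.
Context {k : fieldType} {lam : k} (s : tdtAction lam).

Local Notation H := (otdt_ga lam).
Local Notation t := (ot_ga lam).
Local Notation dt := (odt_ga lam).
Local Notation D := (@ta_t k lam s).
Local Notation E := (@ta_dt k lam s).

Let lD : linear D := om_T (ta_module s).
Let lE : linear E := om_E (ta_module s).
Let lsg n : linear (@gsign k s n) := @gsign_linear k s n.

Definition ta_act : otdt_hopf lam -> s -> s := otdt_act D E.

Lemma ta_t1 : D 1 = 0.
Proof.
by apply: (addrI (D 1)); rewrite addr0 -[RHS](congr1 D (mulr1 1)) ta_tM mulr1 mul1r.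
Qed.

Lemma ta_dt1 : E 1 = 0.
Proof.
by apply: (addrI (E 1)); rewrite addr0 -[RHS](congr1 E (mulr1 1)) ta_dtM gsign1 mulr1 mul1r.
Qed.

(** E shifts the degree by one, so passing it through the n-th power of the parity costs n signs. *)
Lemma ta_dt_gsign n b : E (gsign n b) = (-1) ^+ n *: gsign n (E b).
Proof.
apply: (graded_ext (f := fun b => E (gsign n b))
  (g := fun b => (-1) ^+ n *: gsign n (E b))) b => [a u v|a u v|m b hb].
- by rewrite lsg lE.
- by rewrite lE lsg scalerDr !scalerA mulrC.
rewrite (gsignE _ hb) (linear_funZ _ _ lE) (gsignE _ (ta_dt_deg hb)).
by rewrite scalerA -exprD mulSn addnA addnn -mul2n exprD (exprM _ 2 n) sqrrN !expr1n mul1r.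
Qed.

Lemma ta_t_gsign n b : D (gsign n b) = gsign n (D b).
Proof.
apply: (graded_ext (f := fun b => D (gsign n b)) (g := fun b => gsign n (D b))) b
  => [a u v|a u v|m b hb]; rewrite ?lsg ?lD ?lsg //.
by rewrite (gsignE _ hb) (linear_funZ _ _ lD) (gsignE _ (ta_t_deg hb)).
Qed.

Lemma gsign_tM n (h : H) : gsign n (t * h) = t * gsign n h.
Proof. by rewrite gsignM (gsignE _ (homog_t lam)) mul0n scale1r. Qed.

Lemma ta_act_deg m n (h : H) b : homog m h -> homog n b -> homog (m + n) (ta_act h b).
Proof.
apply: (otdt_act_deg (deg := fun n b => homog n (b : s))).
- by move=> i; apply: homog0.
- by move=> i a y z; apply: homog_lin.
- exact: ta_t_deg.
- exact: ta_dt_deg.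
Qed.

Lemma ta_act_unit (h : otdt_hopf lam) : ta_act h 1 = (counit _ h : k)%:A.
Proof.
have bil := otdt_act_bil (ta_module s).
apply: (otdt_ext (f := fun h : H => ta_act h 1)
  (g := fun h : H => (ocounit h : k)%:A)) h => [a u v|a u v|||h e].
- exact: bil.1.
- by rewrite ocounit_linear scalerDl scalerA.
- by rewrite /ta_act otdt_act1 ocounit1 scale1r.
- by rewrite /ta_act otdt_act_dt ta_dt1 (ocounit_dt lam) scale0r.
rewrite /ta_act (otdt_act_tM (ta_module s)) -/(ta_act h 1) e.
by rewrite (linear_funZ _ _ lD) ta_t1 scaler0 (ocounitM t h) (ocounit_t lam) mul0r scale0r.
Qed.

(** As functions of h, both sides turn left multiplication by t into D: on the right this combines
    the shape of Delta t with the Leibniz rule for D. What remains is h = 1 and h = dt, the latter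
    being the graded Leibniz rule for E. *)
Lemma ta_act_mul n (h : otdt_hopf lam) (b c : s) : homog n b ->
  ta_act h (b * c) =
  tlift (fun h1 h2 => ta_act h1 b * ta_act (gsign n h2) c) (coprod _ h).
Proof.
move=> hb; have mod := ta_module s; have bil := otdt_act_bil mod.
have lg := @gsign_linear k H n.
pose F (h1 h2 : H) := ta_act h1 b * ta_act (gsign n h2) c.
have bF : bilinear_for *:%R *:%R F.
  split=> [h2|h1] a x y; rewrite /F /ta_act ?lg.
    by rewrite (bil.1 b) mulrDl -scalerAl.
  by rewrite (bil.1 c) mulrDr -scalerAr.
have lF := tlift_linear bF.
have FL u : tlift F (oL u) = D (tlift F u).
  apply: (tens_ext (f := fun u => tlift F (oL u)) (g := fun u => D (tlift F u))) u
    => [a x y|a x y|x y]; first by rewrite oL_linear lF.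
    by rewrite lF lD.
  rewrite oLE (linear_funD _ _ lF) !(tliftE _ _ bF) /F ta_tM gsign_tM.
  by rewrite /ta_act !(otdt_act_tM mod).
apply: (otdt_ext (f := fun h : H => ta_act h (b * c))
  (g := fun h : H => tlift F (ocoprod h))) h => [a u v|a u v|||h e].
- exact: bil.1.
- by rewrite ocoprod_linear lF.
- rewrite (ocoprod1 lam) (tliftE _ _ bF) /F gsign1.
  by rewrite /ta_act !otdt_act1.
- rewrite (ocoprod_dt lam) (linear_funD _ _ lF) !(tliftE _ _ bF) /F gsign1.
  rewrite (gsignE _ (homog_dt lam)) /ta_act !otdt_act1.
  rewrite (linear_funZ _ _ (bil.1 c)) !otdt_act_dt ta_dtM.
  by rewrite (gsignE _ hb) mul1n muln1 -scalerAl -scalerAr.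
rewrite (ocoprod_tM h) FL -e.
by rewrite /ta_act (otdt_act_tM mod).
Qed.

Lemma ta_super_module_algebra : super_module_algebra ta_act.
Proof.
have mod := ta_module s; split.
- exact: otdt_act_bil mod.
- exact: ta_act_deg.
- exact: otdt_act1.
- exact: otdt_actM mod.
- exact: ta_act_unit.
- exact: ta_act_mul.
Qed.

(** * The semidirect product algebra *)

(** A name of its own, because the product depends on the action and not only on the two factors. *)
Definition smash : Type := tens s H.
HB.instance Definition _ := GRing.Lmodule.on smash.

(** The future left multiplications by t, by dt (next) and by b (after it); the first two are forced
    by Delta t and Delta dt, with the Koszul sign in the term containing dt. *)
Definition smash_t (u : smash) : smash :=
  tlift (fun b h => D b ⊗ h + b ⊗ (t * h)) u.
Definition smash_dt (u : smash) : smash :=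
  tlift (fun b h => E b ⊗ h + gsign 1 b ⊗ (dt * h)) u.
Definition smash_lmul (b : s) (u : smash) : smash :=
  tlift (fun c h => (b * c) ⊗ h) u.

Lemma smash_t_bil : bilinear_for *:%R *:%R
  (fun (b : s) (h : H) => D b ⊗ h + b ⊗ (t * h)).
Proof.
by apply: bilinearD; split=> [v|u] a x y /=; rewrite ?mul_linr ?lD ?(ten_linl, ten_linr).
Qed.
Lemma smash_dt_bil : bilinear_for *:%R *:%R
  (fun (b : s) (h : H) => E b ⊗ h + gsign 1 b ⊗ (dt * h)).
Proof.
by apply: bilinearD; split=> [v|u] a x y /=;
  rewrite ?mul_linr ?lE ?lsg ?(ten_linl, ten_linr).
Qed.
Lemma smash_lmul_bil b : bilinear_for *:%R *:%R (fun (c : s) (h : H) => (b * c) ⊗ h).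
Proof.
by split=> [v|u] a x y /=; rewrite ?mulrDr -?scalerAr ?(ten_linl, ten_linr).
Qed.

Lemma smash_tE b h : smash_t (b ⊗ h) = D b ⊗ h + b ⊗ (t * h).
Proof. exact: tliftE smash_t_bil. Qed.
Lemma smash_dtE b h : smash_dt (b ⊗ h) = E b ⊗ h + gsign 1 b ⊗ (dt * h).
Proof. exact: tliftE smash_dt_bil. Qed.
Lemma smash_lmulE b c h : smash_lmul b (c ⊗ h) = (b * c) ⊗ h.
Proof. exact: tliftE (smash_lmul_bil b). Qed.

Lemma smash_t_linear : linear smash_t.
Proof. exact: tlift_linear smash_t_bil. Qed.
Lemma smash_dt_linear : linear smash_dt.
Proof. exact: tlift_linear smash_dt_bil. Qed.
Lemma smash_lmul_linear b : linear (smash_lmul b).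
Proof. exact: tlift_linear (smash_lmul_bil b). Qed.
Lemma smash_lmul_linearl u : linear (fun b => smash_lmul b u).
Proof.
apply: (@tlift_param _ _ _ _ _ (fun b (c : s) (h : H) => (b * c) ⊗ h)) => c h a x y.
by rewrite mulrDl -scalerAl ten_linl.
Qed.

Let lT := smash_t_linear.
Let lX := smash_dt_linear.

(** The commutation relation is inherited from the two factors, as D commutes with the parity sigma.
    The square of E ⊗ 1 + sigma ⊗ dt vanishes because E and dt square to zero and E anticommutes
    with sigma. *)
Lemma smash_module : otdt_module lam smash_t smash_dt.
Proof.
split=> // u.
  apply: (tens_ext (f := fun u => smash_dt (smash_t u))
    (g := fun u => smash_t (smash_dt u) + lam *: smash_dt u)) u => [a x y|a x y|b h].
  - by rewrite lT lX.
  - by rewrite lX lT !scalerDr addrACA !scalerA mulrC.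
  rewrite smash_tE smash_dtE (linear_funD _ _ lX) (linear_funD _ _ lT).
  rewrite !smash_dtE !smash_tE dt_t (om_ET (ta_module s)) ta_t_gsign.
  rewrite tensDl tensDr tensZl tensZr !scalerDr !addrA.
  by rewrite [LHS](ACl (1*4*3*5*2*6)).
apply: (tens_ext (f := fun u => smash_dt (smash_dt u)) (g := fun u => 0)) u
  => [a x y|a x y|b h]; rewrite ?scaler0 ?addr0 ?lX //.
rewrite smash_dtE (linear_funD _ _ lX) !smash_dtE (om_EE (ta_module s)) ta_dt_gsign.
rewrite gsign_gsign gsign2 mulrA odt_dt mul0r tens0l tens0r add0r addr0.
by rewrite expr1 scaleN1r -[- _]scaleN1r tensZl scaleN1r subrr.
Qed.

Definition smash_act : otdt lam -> smash -> smash := otdt_act smash_t smash_dt.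

(** The cross relation t b = D b + b t as an identity of operators, which is the Leibniz rule for D;
    the next lemma is its odd counterpart for dt. *)
Lemma smash_lmul_t b u :
  smash_t (smash_lmul b u) = smash_lmul (D b) u + smash_lmul b (smash_t u).
Proof.
have lL c := smash_lmul_linear c.
apply: (tens_ext (f := fun u => smash_t (smash_lmul b u))
  (g := fun u => smash_lmul (D b) u + smash_lmul b (smash_t u))) u => [a x y|a x y|c h].
- by rewrite lL lT.
- by rewrite lT !lL scalerDr addrACA.
by rewrite !smash_lmulE !smash_tE (linear_funD _ _ (lL b)) !smash_lmulE ta_tM tensDl addrA.
Qed.

Lemma smash_lmul_dt b u :
  smash_dt (smash_lmul b u) = smash_lmul (E b) u + smash_lmul (gsign 1 b) (smash_dt u).
Proof.
have lL c := smash_lmul_linear c.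
apply: (tens_ext (f := fun u => smash_dt (smash_lmul b u))
  (g := fun u => smash_lmul (E b) u + smash_lmul (gsign 1 b) (smash_dt u))) u
  => [a x y|a x y|c h].
- by rewrite lL lX.
- by rewrite lX !lL scalerDr addrACA.
rewrite !smash_lmulE !smash_dtE (linear_funD _ _ (lL _)) !smash_lmulE ta_dtM tensDl.
by rewrite gsignM addrA.
Qed.

Lemma smash_lmulM b c u : smash_lmul (b * c) u = smash_lmul b (smash_lmul c u).
Proof.
have lL c := smash_lmul_linear c.
apply: (tens_ext (f := fun u => smash_lmul (b * c) u)
  (g := fun u => smash_lmul b (smash_lmul c u))) u => [a x y|a x y|d h].
- exact: lL.
- by rewrite !lL.
by rewrite !smash_lmulE mulrA.
Qed.

Lemma smash_lmul1 u : smash_lmul 1 u = u.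
Proof.
apply: (tens_ext (f := fun u => smash_lmul 1 u) (g := id)) u => [||b h] //.
  exact: smash_lmul_linear.
by rewrite smash_lmulE mul1r.
Qed.

(** D and E kill 1, so 1 ⊗ H is the orbit of the unit. The right unit law and the products inside H
    follow from this. *)
Lemma smash_act_one (h : H) : smash_act h (1 ⊗ 1) = 1 ⊗ h.
Proof.
have mod := smash_module.
apply: (otdt_ext (f := fun h : H => smash_act h (1 ⊗ 1))
  (g := fun h : H => 1 ⊗ h)) h => [a u v|a u v|||h e].
- exact: (otdt_act_bil mod).1.
- exact: ten_linr.
- exact: otdt_act1.
- rewrite /smash_act otdt_act_dt smash_dtE ta_dt1 gsign1 mulr1.
  by rewrite tens0l add0r.
rewrite /smash_act (otdt_act_tM mod) -/(smash_act h _) e smash_tE ta_t1.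
by rewrite tens0l add0r.
Qed.

(* For this form of the product, associativity says that left multiplication *)
(* turns smash_lmul, smash_t and smash_dt into themselves, which is checked   *)
(* on generators.                                                            *)
Definition smash_mul (u v : smash) : smash :=
  tlift (fun b h => smash_lmul b (smash_act h v)) u.

Lemma smash_mul_inner v : bilinear_for *:%R *:%R
  (fun (b : s) (h : H) => smash_lmul b (smash_act h v)).
Proof.
split=> [h|b] a x y /=; first exact: (smash_lmul_linearl (smash_act h v)).
rewrite /smash_act ((otdt_act_bil smash_module).1 v).
exact: smash_lmul_linear.
Qed.

Lemma smash_mulE b h v : smash_mul (b ⊗ h) v = smash_lmul b (smash_act h v).
Proof. exact: tliftE (smash_mul_inner v). Qed.

Lemma smash_mul_bil : bilinear_for *:%R *:%R smash_mul.
Proof.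
split=> [v|u]; first exact: (tlift_linear (smash_mul_inner v)).
apply: (@tlift_param _ _ _ _ _ (fun v (b : s) (h : H) => smash_lmul b (smash_act h v))).
move=> b h a x y.
by rewrite /smash_act ((otdt_act_bil smash_module).2 h) (smash_lmul_linear b).
Qed.

Let lml v : linear (fun u => smash_mul u v) := smash_mul_bil.1 v.
Let lmr u : linear (smash_mul u) := smash_mul_bil.2 u.

Lemma smash_mul_lmul b u v : smash_mul (smash_lmul b u) v = smash_lmul b (smash_mul u v).
Proof.
have lL := smash_lmul_linear b.
apply: (tens_ext (f := fun u => smash_mul (smash_lmul b u) v)
  (g := fun u => smash_lmul b (smash_mul u v))) u => [a x y|a x y|c h].
- by rewrite lL lml.
- by rewrite lml lL.
by rewrite smash_lmulE !smash_mulE smash_lmulM.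
Qed.

Lemma smash_mul_t u v : smash_mul (smash_t u) v = smash_t (smash_mul u v).
Proof.
apply: (tens_ext (f := fun u => smash_mul (smash_t u) v)
  (g := fun u => smash_t (smash_mul u v))) u => [a x y|a x y|c h].
- by rewrite lT lml.
- by rewrite lml lT.
rewrite smash_tE (linear_funD _ _ (lml v)) !smash_mulE smash_lmul_t.
by rewrite /smash_act (otdt_act_tM smash_module).
Qed.

Lemma smash_mul_dt u v : smash_mul (smash_dt u) v = smash_dt (smash_mul u v).
Proof.
apply: (tens_ext (f := fun u => smash_mul (smash_dt u) v)
  (g := fun u => smash_dt (smash_mul u v))) u => [a x y|a x y|c h].
- by rewrite lX lml.
- by rewrite lml lX.
rewrite smash_dtE (linear_funD _ _ (lml v)) !smash_mulE smash_lmul_dt.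
by rewrite /smash_act (otdt_act_dtM smash_module).
Qed.

(** The action of h is built from [smash_t] and [smash_dt], which both commute with right
    multiplication by v. *)
Lemma smash_mul_act (h : H) u v : smash_mul (smash_act h u) v = smash_act h (smash_mul u v).
Proof.
have mod := smash_module.
apply: (otdt_ext (f := fun h : H => smash_mul (smash_act h u) v)
  (g := fun h : H => smash_act h (smash_mul u v))) h => [a x y|a x y|||h e].
- by rewrite /smash_act ((otdt_act_bil mod).1 u) lml.
- exact: (otdt_act_bil mod).1.
- by rewrite /smash_act !otdt_act1.
- by rewrite /smash_act !otdt_act_dt smash_mul_dt.
by rewrite /smash_act !(otdt_act_tM mod) smash_mul_t -/(smash_act h u) e.
Qed.

Lemma smash_mulA : associative smash_mul.
Proof.
move=> u v w; apply: (tens_ext (f := fun u => smash_mul u (smash_mul v w))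
  (g := fun u => smash_mul (smash_mul u v) w)) u => [a x y|a x y|b h].
- exact: lml.
- by rewrite (lml v) (lml w).
by rewrite !smash_mulE smash_mul_lmul smash_mul_act.
Qed.

Lemma smash_mul1l : left_id (1 ⊗ 1 : smash) smash_mul.
Proof.
by move=> u; rewrite smash_mulE /smash_act otdt_act1 smash_lmul1.
Qed.

Lemma smash_mul1r : right_id (1 ⊗ 1 : smash) smash_mul.
Proof.
move=> u; apply: (tens_ext (f := fun u => smash_mul u (1 ⊗ 1)) (g := id)) u => [||b h] //.
by rewrite smash_mulE smash_act_one smash_lmulE mulr1.
Qed.

Lemma smash_mulDl : left_distributive smash_mul +%R.
Proof. by move=> u v w; apply: (linear_funD u v (lml w)). Qed.
Lemma smash_mulDr : right_distributive smash_mul +%R.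
Proof. by move=> u v w; apply: (linear_funD v w (lmr u)). Qed.

Lemma smash_one_neq0 : (1 ⊗ 1 : smash) != 0.
Proof.
(* The linear map id ⊗ counit sends 1 ⊗ 1 to 1, which is nonzero. *)
apply/eqP => e; pose F (b : s) (h : H) : s := (ocounit h : k) *: b.
have bF : bilinear_for *:%R *:%R F.
  split=> [h|b] a x y; rewrite /F /=; first by rewrite scalerDr !scalerA [a * _]mulrC.
  by rewrite ocounit_linear scalerDl scalerA.
have /eqP := congr1 (tlift F) e.
rewrite (tliftE _ _ bF) (linear_fun0 (tlift_linear bF)) /F (ocounit1 lam) scale1r.
by rewrite oner_eq0.
Qed.

HB.instance Definition _ := GRing.Zmodule_isNzRing.Build smash
  smash_mulA smash_mul1l smash_mul1r smash_mulDl smash_mulDr smash_one_neq0.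

Lemma smash_scaleAl (a : k) (u v : smash) : a *: (u * v) = a *: u * v.
Proof. exact: esym (linear_funZ a u (lml v)). Qed.
HB.instance Definition _ := GRing.Lmodule_isLalgebra.Build k smash smash_scaleAl.

Lemma smash_scaleAr (a : k) (u v : smash) : a *: (u * v) = u * (a *: v).
Proof. exact: esym (linear_funZ a v (lmr u)). Qed.
HB.instance Definition _ := GRing.Lalgebra_isAlgebra.Build k smash smash_scaleAr.

End Smash.

(** * Grading, coproduct formula and universal property of the semidirect product *)

Section SmashGraded.
Context {k : fieldType} {lam : k} (s : tdtAction lam).

Local Notation H := (otdt_ga lam).
Local Notation t := (ot_ga lam).
Local Notation dt := (odt_ga lam).
Local Notation W := (smash s).

Let lT := @smash_t_linear k lam s.
Let lX := @smash_dt_linear k lam s.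

Definition smash_pr (n : nat) : W -> W := @tpr k s H n.
Lemma smash_pr_linear n : linear (smash_pr n). Proof. exact: tpr_linear. Qed.
HB.instance Definition _ n :=
  GRing.isLinear.Build k W W *:%R (smash_pr n) (smash_pr_linear n).

Lemma smash_pr_t n u : smash_pr n (smash_t u) = smash_t (smash_pr n u).
Proof.
elim/(@tens_homog_ind k s H): u => [a x y hx hy|i j b h hb hh].
  by rewrite lT !(smash_pr_linear n) hx hy lT.
rewrite smash_tE (linear_funD _ _ (smash_pr_linear n)) /smash_pr.
rewrite (tprE _ (ta_t_deg hb) hh) (tprE _ hb (homogM (homog_t lam) hh)) (tprE _ hb hh).
by case: eqP => _; rewrite ?smash_tE // (linear_fun0 lT) addr0.
Qed.

Lemma smash_pr_dt n u : smash_pr n.+1 (smash_dt u) = smash_dt (smash_pr n u).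
Proof.
elim/(@tens_homog_ind k s H): u => [a x y hx hy|i j b h hb hh].
  by rewrite lX !smash_pr_linear hx hy lX.
rewrite smash_dtE (linear_funD _ _ (smash_pr_linear n.+1)) /smash_pr.
rewrite (tprE _ (ta_dt_deg hb) hh) (tprE _ (gsign_homog 1 hb) (homogM (homog_dt lam) hh)).
rewrite (tprE _ hb hh) add1n addnS addSn eqSS.
by case: eqP => _; rewrite ?smash_dtE // (linear_fun0 lX) addr0.
Qed.

Lemma smash_pr_lmul m n b u : homog m b ->
  smash_pr (m + n) (smash_lmul b u) = smash_lmul b (smash_pr n u).
Proof.
move=> hb; have lL := smash_lmul_linear b.
elim/(@tens_homog_ind k s H): u => [a x y hx hy|i j c h hc hh].
  by rewrite lL !smash_pr_linear hx hy lL.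
rewrite smash_lmulE /smash_pr (tprE _ (homogM hb hc) hh) (tprE _ hc hh) -addnA eqn_add2l.
by case: eqP => _; rewrite ?smash_lmulE // (linear_fun0 lL).
Qed.

Lemma smash_pr_act m n (h : H) u : homog m h -> smash_pr n u = u ->
  smash_pr (m + n) (smash_act h u) = smash_act h u.
Proof.
apply: (otdt_act_deg (deg := fun n u => smash_pr n u = u)) => [i|i a y z ey ez|i y e|i y e].
- exact: linear0.
- by rewrite smash_pr_linear ey ez.
- by rewrite smash_pr_t e.
- by rewrite smash_pr_dt e.
Qed.

Lemma smash_prM m n (u v : W) : smash_pr m u = u -> smash_pr n v = v ->
  smash_pr (m + n) (u * v) = u * v.
Proof.
(* Writing u as its own component turns the claim into one linear in u, so that induction on tensors
   applies. *)
move=> <- hv; elim/(@tens_homog_ind k s H): u => [a x y hx hy|i j b h hb hh].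
  by rewrite smash_pr_linear mulrDl -scalerAl smash_pr_linear hx hy.
rewrite [smash_pr m _](tprE _ hb hh); case: eqP => [->|_]; last by rewrite mul0r linear0.
by rewrite [_ * _]smash_mulE -addnA (smash_pr_lmul _ _ hb) smash_pr_act.
Qed.

Lemma smash_pr_1 : smash_pr 0 1 = 1.
Proof. by rewrite /smash_pr [LHS](tprE 0 (gpr_1 s) (gpr_1 H)). Qed.

Definition smash_ga : gradedAlg k := @GradedAlg k W (fun n => smash_pr n)
  (@tpr_tpr _ s H) (@tpr_sum _ s H) smash_pr_1 smash_prM.

Definition smash_in (b : s) (h : otdt_hopf lam) : smash_ga := b ⊗ h.

Lemma smash_in_deg m n b (h : H) : homog m b -> homog n h -> homog (m + n) (smash_in b h).
Proof. by move=> hb hh; rewrite /homog [LHS](tprE _ hb hh) eqxx. Qed.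

(** Reconciles the product defined by operators with the coproduct formula: both are compatible with
    left multiplication of h by t, and they agree at h = 1 and h = dt. *)
Lemma smash_in_mul n w (h : otdt_hopf lam) b g : homog n b ->
  smash_in w h * smash_in b g =
  tlift (fun h1 h2 => smash_in (w * ta_act h1 b) (gsign n h2 * g)) (coprod _ h).
Proof.
move=> hb; have mod := ta_module s; have bil := otdt_act_bil mod.
have smod := smash_module s.
have lg := @gsign_linear k H n; have lL := smash_lmul_linear w.
pose F (h1 h2 : H) : W := ta_act h1 b ⊗ (gsign n h2 * g).
have bF : bilinear_for *:%R *:%R F.
  split=> [h2|h1] a x y; rewrite /F /ta_act.
    by rewrite (bil.1 b) ten_linl.
  by rewrite lg mulrDl -scalerAl ten_linr.
pose F' (h1 h2 : H) : W := (w * ta_act h1 b) ⊗ (gsign n h2 * g).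
have bF' : bilinear_for *:%R *:%R F'.
  split=> [h2|h1] a x y; rewrite /F' /ta_act.
    by rewrite (bil.1 b) mulrDr -scalerAr ten_linl.
  by rewrite lg mulrDl -scalerAl ten_linr.
have lF := tlift_linear bF; have lF' := tlift_linear bF'.
(* Both sides depend on w through [smash_lmul w] only, so w is split off. *)
transitivity (smash_lmul w (tlift F (ocoprod h))); last first.
  apply: (tens_ext (f := fun u => smash_lmul w (tlift F u)) (g := tlift F'))
    => [a x y||x y] //; first by rewrite lF lL.
  by rewrite (tliftE _ _ bF) (tliftE _ _ bF') /F smash_lmulE.
rewrite [LHS]smash_mulE; congr smash_lmul.
have FL u : tlift F (oL u) = smash_t (tlift F u).
  apply: (tens_ext (f := fun u => tlift F (oL u)) (g := fun u => smash_t (tlift F u))) u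
    => [a x y|a x y|x y]; first by rewrite oL_linear lF.
    by rewrite lF lT.
  rewrite oLE (linear_funD _ _ lF) !(tliftE _ _ bF) /F smash_tE gsign_tM mulrA.
  by rewrite /ta_act !(otdt_act_tM mod).
apply: (otdt_ext (f := fun h : H => smash_act h (b ⊗ g))
  (g := fun h : H => tlift F (ocoprod h))) h => [a u v|a u v|||h e].
- exact: (otdt_act_bil smod).1.
- by rewrite ocoprod_linear lF.
- rewrite (ocoprod1 lam) (tliftE _ _ bF) /F gsign1 mul1r.
  by rewrite /ta_act /smash_act !otdt_act1.
- rewrite (ocoprod_dt lam) (linear_funD _ _ lF) !(tliftE _ _ bF) /F gsign1 mul1r.
  rewrite (gsignE _ (homog_dt lam)) /ta_act !otdt_act1 otdt_act_dt.
  rewrite /smash_act otdt_act_dt smash_dtE (gsignE _ hb) mul1n muln1 -scalerAl.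
  by rewrite tensZl tensZr.
rewrite (ocoprod_tM h) FL -e.
by rewrite /smash_act (otdt_act_tM smod).
Qed.

Lemma smash_super_semidirect : super_semidirect (@ta_act k lam s) smash_in.
Proof.
split.
- exact: ten_bilinear.
- by exists id; exact: tlift_ten.
- exact: smash_in_deg.
- exact: smash_in_mul.
Qed.

Lemma smash_in_mulr b c (h : H) : smash_in b 1 * smash_in c h = smash_in (b * c) h.
Proof. by rewrite [LHS]smash_mulE /smash_act otdt_act1 smash_lmulE. Qed.

Lemma smash_in_mull b (h g : H) : smash_in b h * smash_in 1 g = smash_in b (h * g).
Proof.
rewrite [LHS]smash_mulE -[smash_in 1 g](smash_act_one s g) /smash_act.
rewrite -(otdt_actM (smash_module s)) -/(smash_act _ _) (smash_act_one s (h * g)).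
by rewrite smash_lmulE mulr1.
Qed.

Definition smash_base (b : s) : smash_ga := smash_in b 1.
Lemma smash_base_linear : linear smash_base.
Proof. by move=> a b c; rewrite /smash_base /smash_in ten_linl. Qed.
HB.instance Definition _ :=
  GRing.isLinear.Build k s smash_ga *:%R smash_base smash_base_linear.
Lemma smash_base_monoid : monoid_morphism smash_base.
Proof. by split=> // b c; rewrite /smash_base smash_in_mulr. Qed.
HB.instance Definition _ :=
  GRing.isMonoidMorphism.Build s smash_ga smash_base smash_base_monoid.

Lemma smash_in_t (x : smash_ga) : smash_in 1 t * x = smash_t x.
Proof. by rewrite [LHS]smash_mulE smash_lmul1 /smash_act (otdt_act_t (smash_module s)). Qed.

Lemma smash_in_dt (x : smash_ga) : smash_in 1 dt * x = smash_dt x.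
Proof. by rewrite [LHS]smash_mulE smash_lmul1 /smash_act otdt_act_dt. Qed.

Lemma gsign_smash_in n b (h : H) : gsign n (smash_in b h) = smash_in (gsign n b) (gsign n h).
Proof.
have lg (G : gradedAlg k) := @gsign_linear k G n.
apply: (graded_ext (f := fun b => gsign n (smash_in b h))
  (g := fun b => smash_in (gsign n b) (gsign n h))) b => [a u v|a u v|i b hb].
- by rewrite /smash_in ten_linl lg.
- by rewrite lg /smash_in ten_linl.
apply: (graded_ext (f := fun h : H => gsign n (smash_in b h))
  (g := fun h : H => smash_in (gsign n b) (gsign n h))) h => [a u v|a u v|j h hh].
- by rewrite /smash_in ten_linr lg.
- by rewrite lg /smash_in ten_linr.
rewrite (gsignE _ hb) (gsignE _ hh) (gsignE _ (smash_in_deg hb hh)) /smash_in.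
by rewrite tensZl tensZr scalerA -exprD mulnDl.
Qed.

(** The algebra is generated by the base, t and dt, since b ⊗ h is the product of b ⊗ 1 and 1 ⊗
    h. *)
Lemma smash_ext (C : algType k) (f g : {lrmorphism smash_ga -> C}) :
  (forall b, f (smash_in b 1) = g (smash_in b 1)) ->
  f (smash_in 1 t) = g (smash_in 1 t) -> f (smash_in 1 dt) = g (smash_in 1 dt) ->
  f =1 g.
Proof.
move=> fb ft fdt; apply: (tens_ext (linearP f) (linearP g)) => b h.
have fM (F : {lrmorphism smash_ga -> C}) (u v : smash_ga) : F (u * v) = F u * F v.
  exact: rmorphM.
change (f (smash_in b h) = g (smash_in b h)).
rewrite -[b]mulr1 -smash_in_mulr (fM f) (fM g) fb; congr (_ * _).
apply: (otdt_ext (f := fun h : H => f (smash_in 1 h))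
  (g := fun h : H => g (smash_in 1 h))) h => [a u v|a u v|||h e] //.
- by rewrite /smash_in ten_linr linearP.
- by rewrite /smash_in ten_linr linearP.
by rewrite -[ot lam * h]/(t * h) -smash_in_mull (fM f) (fM g) ft e.
Qed.

(** With p the map on Omega(t, dt) given by its presentation, b ⊗ h goes to f b times p h. The first
    two hypotheses say that this map turns [smash_t] and [smash_dt] into left multiplication by x
    and y; multiplicativity follows. *)
Lemma smash_universal (C : algType k) (f : {lrmorphism s -> C}) (x y : C) :
  (forall b, x * f b = f (ta_t b) + f b * x) ->
  (forall b, y * f b = f (ta_dt b) + f (gsign 1 b) * y) ->
  y * x - x * y = lam *: y -> y * y = 0 ->
  exists g : {lrmorphism smash_ga -> C},
    [/\ forall b, g (smash_in b 1) = f b, g (smash_in 1 t) = x & g (smash_in 1 dt) = y].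
Proof.
move=> xf yf yx yy; have [p [pt pdt _]] := otdt_presentation yx yy.
have ptM (h : H) : p (t * h) = x * p h by rewrite -pt; apply: rmorphM.
have pdtM (h : H) : p (dt * h) = y * p h by rewrite -pdt; apply: rmorphM.
pose F (b : s) (h : H) := f b * p h.
have bF : bilinear_for *:%R *:%R F.
  split=> [h|b] a u v; rewrite /F linearP /=; first by rewrite mulrDl scalerAl.
  by rewrite mulrDr scalerAr.
pose g := tlift F : smash_ga -> C.
have lg : linear g := tlift_linear bF.
have gE b h : g (smash_in b h) = f b * p h by exact: tliftE.
have gt u : g (smash_t u) = x * g u.
  apply: (tens_ext (f := fun u => g (smash_t u)) (g := fun u => x * g u)) u
    => [a u v|a u v|b h].
  - by rewrite lT lg.
  - by rewrite lg mulrDr scalerAr.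
  rewrite smash_tE (linear_funD _ _ lg) !gE ptM mulrA -mulrDl -xf.
  by rewrite [RHS]mulrA.
have gdt u : g (smash_dt u) = y * g u.
  apply: (tens_ext (f := fun u => g (smash_dt u)) (g := fun u => y * g u)) u
    => [a u v|a u v|b h].
  - by rewrite lX lg.
  - by rewrite lg mulrDr scalerAr.
  by rewrite smash_dtE (linear_funD _ _ lg) !gE pdtM mulrA -mulrDl -yf [RHS]mulrA.
have gl b u : g (smash_lmul b u) = f b * g u.
  apply: (tens_ext (f := fun u => g (smash_lmul b u)) (g := fun u => f b * g u)) u
    => [a u v|a u v|c h].
  - by rewrite smash_lmul_linear lg.
  - by rewrite lg mulrDr scalerAr.
  by rewrite smash_lmulE !gE rmorphM mulrA.
have ga h u : g (smash_act h u) = p h * g u.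
  have mod := smash_module s.
  apply: (otdt_ext (f := fun h : H => g (smash_act h u)) (g := fun h : H => p h * g u)) h
    => [a v w|a v w|||h e].
  - by rewrite /smash_act ((otdt_act_bil mod).1 u) lg.
  - by rewrite linearP mulrDl -scalerAl.
  - by rewrite /smash_act otdt_act1 rmorph1 mul1r.
  - by rewrite /smash_act otdt_act_dt gdt pdt.
  by rewrite /smash_act (otdt_act_tM mod) gt e ptM mulrA.
have gM : monoid_morphism g.
  split=> [|u v]; first by rewrite [LHS](gE 1 1) !rmorph1 mulr1.
  apply: (tens_ext (f := fun u : smash_ga => g (u * v)) (g := fun u => g u * g v)) u
    => [a w w'|a w w'|b h].
  - by rewrite mulrDl -scalerAl lg.
  - by rewrite lg mulrDl -scalerAl.
  by rewrite [X in g X]smash_mulE gl ga gE mulrA.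
pose G1 := GRing.isLinear.Build _ _ _ _ g lg.
pose G2 := GRing.isMonoidMorphism.Build _ _ g gM.
exists (HB.pack g G1 G2 : {lrmorphism smash_ga -> C}); split=> [b||] /=.
- by rewrite gE rmorph1 mulr1.
- by rewrite gE rmorph1 mul1r pt.
by rewrite gE rmorph1 mul1r pdt.
Qed.

End SmashGraded.

(** * The degree-zero subalgebra *)

Section DegreeZero.
Context {k : fieldType} (G : gradedAlg k).

Definition deg0_pred : {pred G} := fun w => gpr G 0 w == w.

Lemma deg0_closed : subalg_closed deg0_pred.
Proof.
split; rewrite /in_mem /= /deg0_pred ?gpr_1 //.
- by move=> a u v /eqP hu /eqP hv; apply/eqP; apply: homog_lin.
- by move=> u v /eqP hu /eqP hv; apply/eqP; apply: (homogM hu hv).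
Qed.

(** For the semidirect product this subalgebra will serve as A_t. *)
Definition deg0 : Type := {w : G | deg0_pred w}.
HB.instance Definition _ := SubChoice.on deg0.
HB.instance Definition _ :=
  GRing.SubChoice_isSubAlgebra.Build k G deg0_pred deg0 (GRing.subalg_closed_semi deg0_closed).

Definition deg0_val (w : deg0) : G := val w.
Lemma deg0_val_linear : linear deg0_val. Proof. exact: linearP. Qed.
HB.instance Definition _ := GRing.isLinear.Build k deg0 G *:%R deg0_val deg0_val_linear.
Lemma deg0_val_monoid : monoid_morphism deg0_val.
Proof. by split=> [|u v]; rewrite /deg0_val ?rmorph1 ?rmorphM. Qed.
HB.instance Definition _ := GRing.isMonoidMorphism.Build deg0 G deg0_val deg0_val_monoid.

Lemma proj0_subproof (w : G) : deg0_pred (gpr G 0 w).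
Proof. by apply/eqP; apply: gpr_homog. Qed.

Definition proj0 (w : G) : deg0 := Sub (gpr G 0 w) (proj0_subproof w).

Lemma val_proj0 w : val (proj0 w) = gpr G 0 w. Proof. exact: SubK. Qed.

Lemma valK0 (w : deg0) : proj0 (val w) = w.
Proof. by apply: val_inj; rewrite val_proj0; apply/eqP: (valP w). Qed.

Lemma proj0_linear : linear proj0.
Proof. by move=> a u v; apply: val_inj; rewrite linearP !val_proj0 linearP. Qed.
HB.instance Definition _ := GRing.isLinear.Build k G deg0 *:%R proj0 proj0_linear.

Lemma proj0_monoid : monoid_morphism proj0.
Proof.
split=> [|u v]; apply: val_inj; first by rewrite rmorph1 val_proj0 gpr_1.
by rewrite rmorphM !val_proj0 gpr0M.
Qed.
HB.instance Definition _ := GRing.isMonoidMorphism.Build G deg0 proj0 proj0_monoid.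

Lemma deg0P (w : G) : homog 0 w <-> exists a : deg0, w = val a.
Proof.
split=> [hw|[a ->]]; first by exists (proj0 w); rewrite val_proj0 hw.
exact/eqP/(valP a).
Qed.

End DegreeZero.

(** * Differentials from a 1-form of square zero *)

Section InnerDga.
Context {k : fieldType} (G : gradedAlg k).

Lemma gcomm_linear n (theta : G) : linear (gcomm n theta).
Proof.
move=> a u v; rewrite /gcomm gsign_lin mulrDr mulrDl -scalerAr -scalerAl.
by rewrite opprD addrACA scalerBr.
Qed.

Lemma gcommZ n a (theta x : G) : gcomm n (a *: theta) x = a *: gcomm n theta x.
Proof. by rewrite /gcomm -scalerAl -scalerAr scalerBr. Qed.

Context (theta : G) (theta1 : homog 1 theta) (theta2 : theta * theta = 0).

Lemma gcomm_deg n w : homog n w -> homog n.+1 (gcomm 1 theta w).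
Proof.
move=> hw; rewrite /gcomm -scaleN1r addrC.
by apply: homog_lin; [rewrite -addn1; apply: homogM (gsign_homog _ hw) theta1
                     |apply: homogM theta1 hw].
Qed.

(** Insert and subtract sigma(v) theta w, where sigma is the parity automorphism. *)
Lemma gcommM n v w : homog n v ->
  gcomm 1 theta (v * w) = gcomm 1 theta v * w + (-1) ^+ n *: (v * gcomm 1 theta w).
Proof.
move=> hv; rewrite scalerAl -[n in _ ^+ n]muln1 -(gsignE _ hv) /gcomm gsignM.
by rewrite mulrBl mulrBr !mulrA addrA subrK.
Qed.

(** The mixed terms theta sigma(w) theta cancel, leaving the ordinary commutator of theta theta with
    w, which is zero. *)
Lemma gcomm_gcomm w : gcomm 1 theta (gcomm 1 theta w) = 0.
Proof.
have sg : gsign 1 (gcomm 1 theta w) = w * theta - theta * gsign 1 w.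
  rewrite /gcomm -scaleN1r addrC gsign_lin !gsignM gsign_gsign gsign2 (gsignE _ theta1).
  by rewrite expr1 !scaleN1r mulrN opprK mulNr.
rewrite [LHS]/(theta * gcomm 1 theta w - gsign 1 (gcomm 1 theta w) * theta) sg /gcomm.
rewrite mulrBr mulrBl mulrA theta2 mul0r sub0r -!mulrA theta2 mulr0 sub0r opprK.
exact: addNr.
Qed.

HB.instance Definition _ :=
  GRing.isLinear.Build k G G *:%R (gcomm 1 theta) (gcomm_linear 1 theta).

Definition inner_dga_of : dga (deg0 G) := @Dga k (deg0 G) G
  (@deg0_val k G : {lrmorphism deg0 G -> G}) val_inj (@deg0P k G) (gcomm 1 theta)
  gcomm_deg gcommM gcomm_gcomm.

Lemma inner_dga_ofP : inner_dga inner_dga_of.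
Proof. by exists theta. Qed.

End InnerDga.

(** * The projection of a DGA onto its degree-zero algebra *)

Section DgaDegreeZero.
Context {k : fieldType} {A : algType k} (Omega : dga A).

Lemma dga_pr0_subproof (w : Omega) : exists a, gpr Omega 0 w = dga_in Omega a.
Proof. exact/(dga_deg0 (gpr Omega 0 w))/gpr_homog. Qed.

(** The algebra map that kills positive degrees and retracts [dga_in]. *)
Definition dga_pr0 (w : Omega) : A := projT1 (cid (dga_pr0_subproof w)).

Lemma dga_pr0E w : dga_in Omega (dga_pr0 w) = gpr Omega 0 w.
Proof. by rewrite /dga_pr0; case: cid. Qed.

Lemma dga_in_homog a : homog 0 (dga_in Omega a).
Proof. by apply/dga_deg0; exists a. Qed.

Lemma dga_pr0K a : dga_pr0 (dga_in Omega a) = a.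
Proof. by apply: (@dga_in_inj _ _ Omega); rewrite dga_pr0E; apply: dga_in_homog. Qed.

Lemma dga_pr0_linear : linear dga_pr0.
Proof.
by move=> a u v; apply: (@dga_in_inj _ _ Omega); rewrite dga_pr0E !linearP /= !dga_pr0E.
Qed.
HB.instance Definition _ := GRing.isLinear.Build k Omega A *:%R dga_pr0 dga_pr0_linear.

Lemma dga_pr0_monoid : monoid_morphism dga_pr0.
Proof.
split=> [|u v]; apply: (@dga_in_inj _ _ Omega); rewrite dga_pr0E ?rmorph1 ?rmorphM /= ?dga_pr0E.
  exact: gpr_1.
exact: gpr0M.
Qed.
HB.instance Definition _ := GRing.isMonoidMorphism.Build Omega A dga_pr0 dga_pr0_monoid.

End DgaDegreeZero.

(** * The action given by tau, and its semidirect product *)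

(** In degree zero dt p(t) = p(t + lam) dt, so the commutator is the finite difference of p times
    dt; in higher degrees both sides vanish. *)
Lemma od_gcomm (k : fieldType) (lam : k) (h : otdt_ga lam) : lam != 0 ->
  gcomm 1 (odt_ga lam) h = lam *: od h.
Proof.
move=> lam0; apply: (graded_ext (f := gcomm 1 (odt_ga lam))
  (g := fun h : otdt_ga lam => lam *: od h)) h => [|a u v|n h hh].
- exact: gcomm_linear.
- by rewrite od_linear scalerDr !scalerA mulrC.
rewrite (gcommE _ _ hh); case: n hh => [|[|n]] <-; apply: oeqP; rewrite /= /oshift;
  rewrite ?comp_poly0 ?mulr0 ?mul0r ?mul1r ?mulr1 ?scaler0 ?addr0 ?add0r ?subr0 ?subrr //.
2: by rewrite mul0n expr0 scale1r scalerA mulfV // scale1r.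
all: by rewrite ?scaler0 oppr0 ?scaler0.
Qed.

Section TauAction.
Context {k : fieldType} (lam : k) {A : algType k} (Omega : dga A).
Context (tau : {linear Omega -> Omega}).
Context (tauM : forall v w : Omega, tau (v * w) = tau v * w + v * tau w).
Context (tau_deg : forall (n : nat) (w : Omega), homog n w -> homog n (tau w)).
Context (tau_d : forall w : Omega, tau (dga_d Omega w) = dga_d Omega (tau w)).

Definition tau_t (w : Omega) : Omega := lam *: (tau w - gdegmul w).
Definition tau_dt (w : Omega) : Omega := lam *: dga_d Omega w.

Lemma tau_tE n w : homog n w -> tau_t w = lam *: (tau w - w *+ n).
Proof. by move=> hw; rewrite /tau_t (gdegmulE hw). Qed.

Lemma tau_t_deg n w : homog n w -> homog n (tau_t w).
Proof.
move=> hw; rewrite (tau_tE hw); apply: homogZ; apply: homogD; first exact: tau_deg.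
by rewrite -scaler_nat -scaleN1r scalerA; apply: homogZ.
Qed.

Lemma tau_dt_deg n w : homog n w -> homog n.+1 (tau_dt w).
Proof. by move=> hw; apply: homogZ; apply: dga_d_deg. Qed.

Lemma tau_t_linear : linear tau_t.
Proof.
move=> a v w; rewrite /tau_t linearP gdegmul_linear opprD addrACA -scalerBr.
by rewrite scalerDr !scalerA mulrC.
Qed.

Lemma tau_dt_linear : linear tau_dt.
Proof. by move=> a v w; rewrite /tau_dt linearP scalerDr !scalerA mulrC. Qed.

(** On degree n, d (tau - n) = (tau - (n + 1)) d + d: the degree term in [tau_t] is what produces
    the relation [dt, t] = lam dt. *)
Lemma tau_module : otdt_module lam tau_t tau_dt.
Proof.
split; [exact: tau_t_linear|exact: tau_dt_linear| |] => w; last first.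
  by rewrite /tau_dt linearZ dga_dd /= !scaler0.
apply: (graded_ext (f := fun w => tau_dt (tau_t w))
  (g := fun w => tau_t (tau_dt w) + lam *: tau_dt w)) w => [a u v|a u v|n w hw].
- by rewrite tau_t_linear tau_dt_linear.
- by rewrite tau_dt_linear tau_t_linear !scalerDr addrACA !scalerA mulrC.
rewrite (tau_tE hw) (tau_tE (tau_dt_deg hw)) /tau_dt !linearZ /= linearB linearMn tau_d.
rewrite -scalerDr; congr (_ *: _).
by rewrite mulrSr opprD addrA subrK scalerMnr -scalerBr.
Qed.

Lemma tau_tM v w : tau_t (v * w) = tau_t v * w + v * tau_t w.
Proof.
apply: (graded_ext (f := fun v => tau_t (v * w))
  (g := fun v => tau_t v * w + v * tau_t w)) v => [a x y|a x y|m v hv].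
- by rewrite mulrDl -scalerAl tau_t_linear.
- by rewrite tau_t_linear !mulrDl -!scalerAl addrACA scalerDr.
apply: (graded_ext (f := fun w => tau_t (v * w))
  (g := fun w => tau_t v * w + v * tau_t w)) w => [a x y|a x y|n w hw].
- by rewrite mulrDr -scalerAr tau_t_linear.
- by rewrite tau_t_linear !mulrDr -!scalerAr addrACA scalerDr.
rewrite (tau_tE hv) (tau_tE hw) (tau_tE (homogM hv hw)) tauM -scalerAl -scalerAr.
rewrite -scalerDr mulrBl mulrBr mulrnDr -mulrnAl -mulrnAr opprD.
by rewrite addrACA.
Qed.

Lemma tau_dtM v w : tau_dt (v * w) = tau_dt v * w + gsign 1 v * tau_dt w.
Proof.
apply: (graded_ext (f := fun v => tau_dt (v * w))
  (g := fun v => tau_dt v * w + gsign 1 v * tau_dt w)) v => [a x y|a x y|m v hv].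
- by rewrite mulrDl -scalerAl tau_dt_linear.
- by rewrite tau_dt_linear gsign_lin !mulrDl -!scalerAl addrACA scalerDr.
rewrite /tau_dt (dga_dM _ hv) (gsignE _ hv) muln1 scalerDr -!scalerAl -scalerAr.
by rewrite !scalerA mulrC.
Qed.

Definition tau_action : tdtAction lam :=
  TdtAction tau_module tau_t_deg tau_dt_deg tau_tM tau_dtM.

Local Notation W := (smash_ga tau_action).
Local Notation t := (ot_ga lam).
Local Notation dt := (odt_ga lam).
Local Notation jn := (@smash_in k lam tau_action).

Definition tau_base : {lrmorphism A -> deg0 W} :=
  @proj0 k W \o (@smash_base k lam tau_action \o dga_in Omega).

Lemma val_tau_base a : val (tau_base a) = jn (dga_in Omega a) 1.
Proof.
rewrite val_proj0; exact: (smash_in_deg (s := tau_action) (dga_in_homog Omega a) (homog_1 lam)).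
Qed.

Definition tau_gen : deg0 W := proj0 (jn 1 t).

Lemma val_tau_gen : val tau_gen = jn 1 t.
Proof.
rewrite val_proj0; exact: (smash_in_deg (s := tau_action) (gpr_1 Omega) (homog_t lam)).
Qed.

Lemma smash_in_tM w : jn 1 t * jn w 1 = jn (tau_t w) 1 + jn w 1 * jn 1 t.
Proof. by rewrite smash_in_t [LHS]smash_tE smash_in_mulr !mulr1. Qed.

(** Existence restricts to degree zero a map defined on the whole semidirect product; uniqueness
    pulls maps back along the projection to degree zero. *)
Lemma tau_generated (tauA : A -> A) :
  (forall a, dga_in Omega (tauA a) = tau (dga_in Omega a)) ->
  generated_by_t lam tauA tau_base tau_gen.
Proof.
move=> tauAE.
have tin a : tau_t (dga_in Omega a) = lam *: dga_in Omega (tauA a).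
  by rewrite (tau_tE (dga_in_homog Omega a)) mulr0n subr0 tauAE.
(* In degree zero the degree term of [tau_t] disappears, and tau preserves degrees. *)
have tpr0 w : dga_pr0 (tau_t w) = lam *: tauA (dga_pr0 w).
  apply: (@dga_in_inj _ _ Omega); rewrite dga_pr0E [RHS]linearZ /= tauAE dga_pr0E.
  apply: (graded_ext (f := fun w => gpr Omega 0 (tau_t w))
    (g := fun w => lam *: tau (gpr Omega 0 w))) w => [a u v|a u v|n w hw].
  - by rewrite tau_t_linear linearP.
  - by rewrite (linearP (gpr Omega 0)) (linearP tau) scalerDr !scalerA mulrC.
  rewrite (gprE _ hw) (gprE _ (tau_t_deg hw)); case: n hw => [|n] hw /=.
    by rewrite (tau_tE hw) mulr0n subr0.
  by rewrite linear0 scaler0.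
have dtpr0 w : dga_pr0 (tau_dt w) = 0.
  apply: (@dga_in_inj _ _ Omega); rewrite dga_pr0E linear0.
  apply: (graded_ext (f := fun w => gpr Omega 0 (tau_dt w)) (g := fun _ => 0)) w
    => [a u v|a u v|n w hw].
  - by rewrite tau_dt_linear linearP.
  - by rewrite scaler0 addr0.
  by rewrite (gprE _ (tau_dt_deg hw)).
split=> [a|C f c fc].
  apply: val_inj.
  transitivity (val tau_gen * val (tau_base a) - val (tau_base a) * val tau_gen).
    by rewrite linearB !rmorphM.
  transitivity (lam *: val (tau_base (tauA a))); last by rewrite linearZ.
  rewrite !val_tau_base val_tau_gen smash_in_tM addrK tin; exact: tensZl.
(* f vanishes on positive degrees of Omega, and dt is sent to 0. *)
pose f0 : {lrmorphism Omega -> C} := f \o @dga_pr0 k A Omega.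
have [|||| g [gf gt gdt]] := @smash_universal k lam tau_action C f0 c 0.
- by move=> w; rewrite /f0 /= tpr0 linearZ /= -fc subrK.
- by move=> w; rewrite mul0r mulr0 addr0 /f0 /= dtpr0 linear0.
- by rewrite mul0r mulr0 subrr scaler0.
- by rewrite mul0r.
exists (g \o @deg0_val k W : {lrmorphism deg0 W -> C}); split=> [a||g' g'a g't w] /=.
- by rewrite /deg0_val val_tau_base gf /f0 /= dga_pr0K.
- by rewrite /deg0_val val_tau_gen gt.
(* Precomposed with [proj0], both maps live on the whole algebra, where it suffices to compare them
   on the base, t and dt. *)
pose g1 : {lrmorphism W -> C} := g' \o @proj0 k W.
pose g2 : {lrmorphism W -> C} := (g \o @deg0_val k W) \o @proj0 k W.
suff e : g1 =1 g2 by have := e (val w); rewrite /g1 /g2 /= !valK0.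
have t0 : gpr W 0 (jn 1 t) = jn 1 t by rewrite -val_proj0 val_tau_gen.
have dt0 : gpr W 0 (jn 1 dt) = 0.
  exact: (gprE 0 (smash_in_deg (s := tau_action) (gpr_1 Omega) (homog_dt lam))).
have b0 b : gpr W 0 (jn b 1) = jn (gpr Omega 0 b) 1.
  apply: (graded_ext (f := fun b => gpr W 0 (jn b 1))
    (g := fun b => jn (gpr Omega 0 b) 1)) b => [a u v|a u v|n b hb].
  - by rewrite /smash_in ten_linl linearP.
  - by rewrite linearP /smash_in ten_linl.
  rewrite (gprE _ hb) (gprE _ (smash_in_deg (s := tau_action) hb (homog_1 lam))) addn0.
  by case: eqP => // _; rewrite /smash_in tens0l.
apply: smash_ext => [b||]; rewrite /g1 /g2 /= /deg0_val ?val_proj0.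
- have -> : proj0 (jn b 1) = tau_base (dga_pr0 b).
    by apply: val_inj; rewrite val_tau_base dga_pr0E val_proj0 b0.
  by rewrite g'a b0 gf /f0 /= -dga_pr0E dga_pr0K.
- by rewrite t0 gt.
have -> : proj0 (jn 1 dt) = 0 :> deg0 W by apply: val_inj; rewrite val_proj0 dt0.
by rewrite dt0 !linear0.
Qed.

Context (lam0 : lam != 0).

Definition tau_theta : W := lam^-1 *: jn 1 dt.

Lemma smash_dt_homog : homog 1 (jn 1 dt).
Proof. exact: (smash_in_deg (s := tau_action) (gpr_1 Omega) (homog_dt lam)). Qed.

Lemma tau_theta_homog : homog 1 tau_theta.
Proof. exact/homogZ/smash_dt_homog. Qed.

Lemma tau_theta2 : tau_theta * tau_theta = 0.
Proof.
rewrite -scalerAl -scalerAr smash_in_mull [dt * dt](odt_dt lam) /smash_in tens0r.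
by rewrite !scaler0.
Qed.

Definition tau_dga : dga (deg0 W) := inner_dga_of tau_theta_homog tau_theta2.

Lemma tau_dgaE x : gcomm 1 (jn 1 dt) x = lam *: dga_d tau_dga x.
Proof. by rewrite [dga_d _ _]gcommZ scalerA mulfV // scale1r. Qed.

(** Left multiplication of w by dt gives lam d w plus sigma(w) dt, with sigma the parity; the last
    term is the one that the graded commutator subtracts. *)
Lemma tau_dga_base w : dga_d tau_dga (jn w 1) = jn (dga_d Omega w) 1.
Proof.
rewrite [LHS]gcommZ /gcomm gsign_smash_in gsign1 smash_in_dt smash_in_mull mul1r.
rewrite [smash_dt _]smash_dtE mulr1 addrK /tau_dt tensZl scalerA mulVf // scale1r.
by [].
Qed.

Lemma tau_dga_otdt (h : otdt_ga lam) : dga_d tau_dga (jn 1 h) = jn 1 (od h).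
Proof.
rewrite [LHS]gcommZ /gcomm gsign_smash_in gsign1 !smash_in_mull.
have -> : jn 1 (dt * h) - jn 1 (gsign 1 h * dt) = jn 1 (gcomm 1 dt h).
  by rewrite /gcomm -scaleN1r addrC /smash_in -ten_linr scaleN1r addrC.
by rewrite (od_gcomm _ lam0) /smash_in tensZr scalerA mulVf // scale1r.
Qed.

End TauAction.

Theorem proposition4p1 (k : fieldType) (lam : k) (lam_neq0 : lam != 0)
    (A : algType k) (Omega : dga A) (tau : {linear Omega -> Omega})
    (tauM : forall v w : Omega, tau (v * w) = tau v * w + v * tau w)
    (tau_deg : forall (n : nat) (w : Omega), homog n w -> homog n (tau w))
    (tau_d : forall w : Omega, tau (dga_d Omega w) = dga_d Omega (tau w))
    (tauA : A -> A)
    (tauAE : forall a : A, dga_in Omega (tauA a) = tau (dga_in Omega a)) :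
  exists act : otdt_hopf lam -> Omega -> Omega,
    super_module_algebra act /\
    exists (At : algType k) (iA : {lrmorphism A -> At}) (t : At),
      generated_by_t lam tauA iA t /\
      exists (OmegaAt : dga At) (j : Omega -> otdt_hopf lam -> OmegaAt),
        super_semidirect act j /\
        (forall a : A, dga_in OmegaAt (iA a) = j (dga_in Omega a) 1) /\
        dga_in OmegaAt t = j 1 (ot_ga lam) /\
        (forall w : Omega, dga_d OmegaAt (j w 1) = j (dga_d Omega w) 1) /\
        (forall h : otdt_ga lam,
           dga_d OmegaAt (j 1 h) = j 1 (dga_d (otdt_dga lam) h)) /\
        inner_dga OmegaAt /\
        (forall (n : nat) (w : Omega), homog n w ->
           j 1 (ot_ga lam) * j w 1 - j w 1 * j 1 (ot_ga lam) =
           lam *: j (tau w - w *+ n) 1) /\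
        homog 1 (j 1 (odt_ga lam)) /\
        (forall x : OmegaAt,
           gcomm 1 (j 1 (odt_ga lam)) x = lam *: dga_d OmegaAt x).
Proof.
pose s := tau_action lam tauM tau_deg tau_d.
exists (@ta_act k lam s); split; first exact: (ta_super_module_algebra s).
exists (deg0 (smash_ga s)), (tau_base lam tauM tau_deg tau_d),
  (tau_gen lam tauM tau_deg tau_d); split; first exact: tau_generated.
exists (tau_dga lam tauM tau_deg tau_d), (@smash_in k lam s).
split; first exact: (smash_super_semidirect s).
split; first exact: val_tau_base.
split; first exact: val_tau_gen.
split; first exact: tau_dga_base.
split; first exact: tau_dga_otdt.
split; first exact: inner_dga_ofP.
split.
  (* In t w = [tau_t] w + w t the term w t cancels. *)
  move=> n w hw; rewrite smash_in_tM addrK (tau_tE lam tau hw); exact: tensZl.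
by split; [exact: smash_dt_homog | exact: tau_dgaE].
Qed.
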